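(* Let $(M,E)$ be a Finsler space, let $R$ be the h-curvature tensor of its Cartan connection, and let $\mu_R$ be the index of nullity of $R$. If $\mu_R$ is constant on an open subset $U$ of $TM$, then the nullity distribution $z\mapsto \mathcal{N}_R(z)$ is completely integrable on $U$.
   Context: Setting (Klein–Grifone approach). $M$ is a smooth $n$-dimensional manifold, $\mathcal{T}M\subset TM$ is the bundle of nonzero tangent vectors, and $X,Y,Z$ denote vector fields on $TM$ (objects are smooth on $\mathcal{T}M$). $J$ is the natural almost tangent structure of $TM$ (locally $J\partial_{x^i}=\partial_{y^i}$, $J\partial_{y^i}=0$), $C$ is the Liouville vector field (locally $y^i\partial_{y^i}$), and $V(TM)=\operatorname{Im}J=\ker J$. A Finsler space $(M,E)$ is given by $E:TM\to\mathbb{R}$ with $E>0$ on $\mathcal{T}M$, $E(0)=0$, $E$ of class $C^\infty$ on $\mathcal{T}M$ and $C^1$ on $TM$, $\mathcal{L}_CE=2E$, and $\Omega:=dd_JE$ (where $d_JE=dE\circ J$) of maximal rank. The canonical spray $S$ is defined by $i_S\Omega=-dE$. The Barthel connection is $\Gamma=[J,S]$, i.e. $\Gamma X=[JX,S]-J[X,S]$. Put $h=\frac12(I+\Gamma)$, $v=\frac12(I-\Gamma)$, and $H(TM)=\operatorname{Im}h$ (rank $n$). The almost complex structure $F$ is defined by $FJ=h$, $Fh=-J$. The metric $g$ is $g(X,Y)=\Omega(X,FY)$, so that $g(JX,JY)=\Omega(JX,Y)$. The Berwald connection $D^\circ$ is the linear connection on $TM$ with $D^\circ_{JX}JY=J[JX,Y]$,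 $D^\circ_{hX}JY=v[hX,JY]$, $D^\circ F=0$. The first and second Cartan tensors $\mathcal{C},\mathcal{C}'$ are the symmetric semi-basic (vertical-valued) tensors given by $\Omega(\mathcal{C}(X,Y),Z)=\frac12(\mathcal{L}_{JX}(J^*g))(Y,Z)$ and $\Omega(\mathcal{C}'(X,Y),Z)=\frac12(\mathcal{L}_{hX}g)(JY,JZ)$, where $(J^*g)(Y,Z)=g(JY,JZ)$. The Cartan connection $D$ is the linear connection on $TM$ with $D_{JX}JY=D^\circ_{JX}JY+\mathcal{C}(X,Y)$, $D_{hX}JY=D^\circ_{hX}JY+\mathcal{C}'(X,Y)$, $DF=0$. With $K(A,B)=[D_A,D_B]-D_{[A,B]}$ the curvature of $D$, the h-curvature is $R(X,Y)Z=K(hX,hY)JZ$. The nullity space of $R$ at $z$ is $\mathcal{N}_R(z)=\{X\in H_z(TM): R(X,Y)=0\ \forall\,Y\in T_z(TM)\}$, and $\mu_R(z)=\dim\mathcal{N}_R(z)$ is the index of nullity. Where $\mu_R$ is constant, $z\mapsto\mathcal{N}_R(z)$ defines the nullity distribution $\mathcal{N}_R$. Completely integrable means: if vector fields $X,Y$ belong to $\mathcal{N}_R$ then $[X,Y]$ belongs to $\mathcal{N}_R$. *)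

(* Defs.v *)
From HB Require Import structures.
From mathcomp Require Import all_boot all_order all_algebra.
From mathcomp Require Import all_classical all_reals all_analysis.

Set Implicit Arguments.
Unset Strict Implicit.
Unset Printing Implicit Defensive.

Import Order.TTheory GRing.Theory Num.Theory.
Import numFieldNormedType.Exports.

Local Open Scope classical_set_scope.
Local Open Scope ring_scope.

(* [f] is of class C^k on the open set [O].  Since the source is finite
   dimensional, [x |-> 'd f x] is C^k iff each [x |-> 'd f x v] is. *)
Fixpoint class_C (R : realType) (m : nat) (V : normedModType R) (k : nat)
    (O : set 'rV[R]_m) (f : 'rV[R]_m -> V) : Prop :=
  match k with
  | 0 => forall x, O x -> {for x, continuous f}
  | k'.+1 => (forall x, O x -> differentiable f x) /\
             (forall v, class_C k' O (fun x => 'd f x v))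
  end.

Definition class_Coo (R : realType) (m : nat) (V : normedModType R)
    (O : set 'rV[R]_m) (f : 'rV[R]_m -> V) : Prop :=
  forall k, class_C k O f.

(* A set with a family of m-dimensional charts: [coord c] is the coordinate map,
   meaningful on [dom c], and [param c] its inverse, meaningful on
   [coord c @` dom c].  [chart_at p] is a preferred chart around p; it is used
   to represent the tangent space at p by 'rV_m.  The axioms are in
   [smooth_manifold]. *)
Record charted (R : realType) (m : nat) := Charted {
  point :> Type;
  chart : Type;
  dom : chart -> set point;
  coord : chart -> point -> 'rV[R]_m;
  param : chart -> 'rV[R]_m -> point;
  chart_at : point -> chart
}.

Section charted_theory.
Context {R : realType} {m : nat} (N : charted R m).

(* The topology induced by the charts. *)
Definition open_in (W : set N) : Prop :=
  forall c : chart N, open (coord c @` (W `&` dom c)).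

Definition smooth_manifold : Prop :=
  [/\ (forall p : N, dom (chart_at p) p),
      (forall (c : chart N) (p : N), dom c p -> param c (coord c p) = p),
      (forall c c' : chart N,
         open (coord c @` (dom c `&` dom c')) /\
         class_Coo (coord c @` (dom c `&` dom c')) (coord c' \o param c)),
      (forall p q : N, p <> q -> exists A B : set N,
         [/\ open_in A, open_in B, A p, B q & A `&` B = set0]) &
      (exists B : nat -> set N, (forall i, open_in (B i)) /\
         forall (W : set N) (p : N), open_in W -> W p ->
           exists2 i, B i p & B i `<=` W)].

Definition function_C (k : nat) (W : set N) (f : N -> R) : Prop :=
  forall c : chart N,
    class_C k (coord c @` (W `&` dom c)) (f \o param c : 'rV[R]_m -> R).

Definition smooth_function_on (W : set N) (f : N -> R) : Prop :=
  forall k, function_C k W f.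

(* T_p N is 'rV_m, a tangent vector being given by its components in the chart
   [chart_at p]; [components c p xi] are its components in the chart [c]. *)
Definition components (c : chart N) (p : N) (xi : 'rV[R]_m) : 'rV[R]_m :=
  'd (coord c \o param (chart_at p)) (coord (chart_at p) p) xi.

(* A vector field is a total function, considered only on the set where it is
   assumed to be smooth. *)
Definition vfield := N -> 'rV[R]_m.

Definition local_rep (c : chart N) (X : vfield) : 'rV[R]_m -> 'rV[R]_m :=
  fun u => components c (param c u) (X (param c u)).

Definition smooth_on (W : set N) (X : vfield) : Prop :=
  forall c : chart N, class_Coo (coord c @` (W `&` dom c)) (local_rep c X).

Definition smooth_near (p : N) (X : vfield) : Prop :=
  exists W, [/\ open_in W, W p & smooth_on W X].

Definition smooth_function_near (p : N) (f : N -> R) : Prop :=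
  exists W, [/\ open_in W, W p & smooth_function_on W f].

Definition germ_eq (p : N) (X Y : vfield) : Prop :=
  exists W, [/\ open_in W, W p & forall q, W q -> X q = Y q].

Definition vadd (X Y : vfield) : vfield := fun p => X p + Y p.
Definition vopp (X : vfield) : vfield := fun p => - X p.
Definition vscale (f : N -> R) (X : vfield) : vfield := fun p => f p *: X p.
Definition vsub (X Y : vfield) : vfield := vadd X (vopp Y).

(* The derivative X f = df(X). *)
Definition act (X : vfield) (f : N -> R) : N -> R := fun p =>
  'd (f \o param (chart_at p) : 'rV[R]_m -> R) (coord (chart_at p) p) (X p).

(* In coordinates, [X, Y] = dY(X) - dX(Y). *)
Definition bracket (X Y : vfield) : vfield := fun p =>
  let c := chart_at p in
  'd (local_rep c Y) (coord c p) (X p) - 'd (local_rep c X) (coord c p) (Y p).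

(* A linear connection over the open set [O], as an operator on local vector
   fields. *)
Definition linear_connection (O : set N) (D : vfield -> vfield -> vfield) :=
  forall p, O p ->
  [/\ (forall X Y, smooth_near p X -> smooth_near p Y -> smooth_near p (D X Y)),
      (forall X X' Y Y', smooth_near p X -> smooth_near p Y ->
         germ_eq p X X' -> germ_eq p Y Y' -> D X Y p = D X' Y' p),
      (forall X X' Y, smooth_near p X -> smooth_near p X' -> smooth_near p Y ->
         D (vadd X X') Y p = D X Y p + D X' Y p) /\
      (forall f X Y, smooth_function_near p f ->
         smooth_near p X -> smooth_near p Y ->
         D (vscale f X) Y p = f p *: D X Y p),
      (forall X Y Y', smooth_near p X -> smooth_near p Y -> smooth_near p Y' ->
         D X (vadd Y Y') p = D X Y p + D X Y' p) &
      (forall f X Y, smooth_function_near p f ->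
         smooth_near p X -> smooth_near p Y ->
         D X (vscale f Y) p = act X f p *: Y p + f p *: D X Y p)].

Definition curvature (D : vfield -> vfield -> vfield) (A B Z : vfield) : vfield :=
  vsub (vsub (D A (D B Z)) (D B (D A Z))) (D (bracket A B) Z).

Definition has_dim (V : set 'rV[R]_m) (k : nat) : Prop :=
  exists A : 'M[R]_(k, m), row_free A /\ V = [set xi | (xi <= A)%MS].

Definition in_distribution (W : set N) (Delta : N -> set 'rV[R]_m) (X : vfield) :=
  forall p, W p -> Delta p (X p).

Definition completely_integrable (W : set N) (Delta : N -> set 'rV[R]_m) :=
  forall X Y : vfield, smooth_on W X -> smooth_on W Y ->
    in_distribution W Delta X -> in_distribution W Delta Y ->
    in_distribution W Delta (bracket X Y).

End charted_theory.

Arguments vfield {R m} N.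

(* The tangent bundle TM: a point is (x, v), v being given by its components in
   [chart_at x].  Each chart c of M induces the chart (x, v) |-> (x^i, y^i),
   where the y^i are the components of v in c. *)
Definition tangent_bundle (R : realType) (n : nat) (M : charted R n) :
    charted R (n + n) :=
  @Charted R (n + n) (M * 'rV[R]_n)%type (chart M)
    (fun c => [set z | dom c z.1])
    (fun c z => row_mx (coord c z.1) (components c z.1 z.2))
    (fun c w => let x := param c (lsubmx w) in
       (x, 'd (coord (chart_at x) \o param c) (lsubmx w) (rsubmx w)))
    (fun z => chart_at z.1).

Section finsler.
Context {R : realType} {n : nat} (M : charted R n).
Local Notation TM := (tangent_bundle M).
Local Notation VF := (vfield TM).

Definition slit : set TM := [set z | z.2 != 0].

(* The components of a tangent vector to TM at (x, v) are taken in the chart of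
   TM induced by [chart_at x], so that J and C have their usual local
   expressions: J (a, b) = (0, a) and C = (0, v). *)
Definition Jmx : 'M[R]_(n + n) := block_mx 0 1%:M 0 0.
Definition J (X : VF) : VF := fun z => X z *m Jmx.
Definition liouville : VF := fun z => row_mx 0 z.2.

Section energy.
Variable E : TM -> R.

Definition dJ_energy (X : VF) : TM -> R := act (J X) E.

(* Omega = d d_J E, with d w (X, Y) = X w(Y) - Y w(X) - w([X, Y]). *)
Definition Omega (X Y : VF) : TM -> R := fun z =>
  act X (dJ_energy Y) z - act Y (dJ_energy X) z - dJ_energy (bracket X Y) z.

Definition finsler_space : Prop :=
  [/\ (forall z, slit z -> 0 < E z) /\ (forall x : M, E (x, 0) = 0),
      smooth_function_on slit E,
      function_C 1 setT E,
      (forall z, slit z -> act liouville E z = 2%:R * E z) &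
      (forall z, slit z -> forall X, smooth_near z X ->
         (forall Y, smooth_near z Y -> Omega X Y z = 0) -> X z = 0)].

(* i_S Omega = - dE *)
Definition canonical_spray (S : VF) : Prop :=
  smooth_on slit S /\
  forall z, slit z -> forall X, smooth_near z X -> Omega S X z = - act X E z.

Section barthel.
Variable S : VF.

Definition Gamma (X : VF) : VF := vsub (bracket (J X) S) (J (bracket X S)).
Definition hproj (X : VF) : VF := vscale (fun=> 2%:R^-1) (vadd X (Gamma X)).
Definition vproj (X : VF) : VF := vscale (fun=> 2%:R^-1) (vsub X (Gamma X)).

Definition horizontal (z : TM) : set 'rV[R]_(n + n) :=
  [set xi | exists2 X : VF, smooth_near z X & hproj X z = xi].

Section almost_complex.
(* A vector 1-form on TM, as a field of matrices acting on row vectors. *)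
Variable F : TM -> 'M[R]_(n + n).

Definition Fop (X : VF) : VF := fun z => X z *m F z.

Definition almost_complex_structure : Prop :=
  forall z, slit z -> forall X, smooth_near z X ->
    Fop (J X) z = hproj X z /\ Fop (hproj X) z = - J X z.

Definition metric (X Y : VF) : TM -> R := Omega X (Fop Y).

Definition parallel_F (D : VF -> VF -> VF) : Prop :=
  forall z, slit z -> forall X Y, smooth_near z X -> smooth_near z Y ->
    D X (Fop Y) z = Fop (D X Y) z.

Definition berwald_connection (D0 : VF -> VF -> VF) : Prop :=
  [/\ linear_connection slit D0,
      (forall z, slit z -> forall X Y, smooth_near z X -> smooth_near z Y ->
         D0 (J X) (J Y) z = J (bracket (J X) Y) z),
      (forall z, slit z -> forall X Y, smooth_near z X -> smooth_near z Y ->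
         D0 (hproj X) (J Y) z = vproj (bracket (hproj X) (J Y)) z) &
      parallel_F D0].

Definition tensor2 := TM -> 'rV[R]_(n + n) -> 'rV[R]_(n + n) -> 'rV[R]_(n + n).

Definition tapp (T : tensor2) (X Y : VF) : VF := fun z => T z (X z) (Y z).

Definition symmetric_semibasic (T : tensor2) : Prop :=
  forall z, slit z ->
  [/\ (forall a xi xi' eta, T z (a *: xi + xi') eta = a *: T z xi eta + T z xi' eta),
      (forall xi eta, T z xi eta = T z eta xi),
      (forall xi eta, T z (xi *m Jmx) eta = 0),
      (forall xi eta, T z xi eta *m Jmx = 0) &
      (forall X Y, smooth_near z X -> smooth_near z Y ->
         smooth_near z (tapp T X Y))].

(* (L_A w)(Y, Z) for a covariant 2-tensor w *)
Definition lie_derivative2 (w : VF -> VF -> TM -> R) (A Y Z : VF) : TM -> R :=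
  fun z => act A (w Y Z) z - w (bracket A Y) Z z - w Y (bracket A Z) z.

Definition Jmetric (X Y : VF) : TM -> R := metric (J X) (J Y).

Definition first_cartan_tensor (T : tensor2) : Prop :=
  symmetric_semibasic T /\
  forall z, slit z -> forall X Y Z,
    smooth_near z X -> smooth_near z Y -> smooth_near z Z ->
    Omega (tapp T X Y) Z z = 2%:R^-1 * lie_derivative2 Jmetric (J X) Y Z z.

Definition second_cartan_tensor (T : tensor2) : Prop :=
  symmetric_semibasic T /\
  forall z, slit z -> forall X Y Z,
    smooth_near z X -> smooth_near z Y -> smooth_near z Z ->
    Omega (tapp T X Y) Z z =
      2%:R^-1 * lie_derivative2 metric (hproj X) (J Y) (J Z) z.

Definition cartan_connection (D0 : VF -> VF -> VF) (T T' : tensor2)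
    (D : VF -> VF -> VF) : Prop :=
  [/\ linear_connection slit D,
      (forall z, slit z -> forall X Y, smooth_near z X -> smooth_near z Y ->
         D (J X) (J Y) z = D0 (J X) (J Y) z + tapp T X Y z),
      (forall z, slit z -> forall X Y, smooth_near z X -> smooth_near z Y ->
         D (hproj X) (J Y) z = D0 (hproj X) (J Y) z + tapp T' X Y z) &
      parallel_F D].

End almost_complex.

Definition h_curvature (D : VF -> VF -> VF) (X Y Z : VF) : VF :=
  curvature D (hproj X) (hproj Y) (J Z).

(* The condition R(xi, Y) = 0 is tested on local extensions X of xi, R being
   a tensor. *)
Definition nullity_space (D : VF -> VF -> VF) (z : TM) : set 'rV[R]_(n + n) :=
  [set xi | horizontal z xi /\
     forall X Y Z : VF, smooth_near z X -> smooth_near z Y -> smooth_near z Z ->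
       X z = xi -> h_curvature D X Y Z z = 0].

Definition nullity_index (D : VF -> VF -> VF) (z : TM) (k : nat) : Prop :=
  has_dim (nullity_space D z) k.

End barthel.
End energy.
End finsler.

(* Main.v *)
From Pilot Require Import Defs.
From HB Require Import structures.
From mathcomp Require Import all_boot all_order all_algebra.
From mathcomp Require Import all_classical all_reals all_analysis.
From mathcomp Require Import ring lra.
(* Imported again so that [coord] and [dom] are those of a chart. *)
Import Pilot.Defs.

(** Let C be the Liouville field, h and v the projectors of the Barthel connection,
D the Cartan connection and K its curvature.

The nullity of R controls the curvature of the Barthel connection. Indeed
D_{hX} C = 0 and D_{JX} C = JX, whence K(hX, hY) C = - v[hX, hY]
([h_curvature_spray]). Since C = JS, a field X of the nullity distribution satisfies
v[X, B] = 0 for every horizontal field B: its bracket with a horizontal field is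
horizontal ([null_bracket]). In particular, [X, Y] is horizontal if X and Y lie in
the nullity distribution.

For such X and horizontal B, K(X, B) = 0 on vertical fields, that is
D_{[X, B]} = D_X D_B - D_B D_X. As [X, B] and [Y, B] are again horizontal, the Jacobi
identities for vector fields and for commutators of operators combine into
D_{[[X, Y], B]} = [D_{[X, Y]}, D_B], that is K([X, Y], B) = 0 ([null_bianchi]). Hence
[X, Y] lies in the nullity distribution.

The formulas for the derivatives of C rest on the homogeneity of the energy. From
i_S Omega = - dE one gets JS = C, S E = 0, hX E = 0 and [C, S] = S; the latter makes
horizontal lifts of coordinate fields commute with C
([bracket_hproj_dx_liouville]). The two Cartan tensors vanish on S
([second_cartan_tensor_spray], [first_cartan_tensor_spray]). Each of these equalities
between vertical vectors is proved by evaluating on the functions E_{y^i}, which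
suffices because Omega is nondegenerate ([vertical_eq0]).

The underlying calculus treats vector fields as derivations of germs of smooth
functions. The derivative X f can be computed in any chart ([act_chart]), it
determines X ([vector_eq]), and a bracket acts as a commutator ([act_bracket]), by
the symmetry of second differentials ([diff_diffC]). The Leibniz rules and the Jacobi
identity follow. An expression in X which is linear over smooth functions depends
only on the value of X at the point ([tensorial_eq]), so that it is enough to compute
it on coordinate fields. *)

Set Implicit Arguments.
Unset Strict Implicit.
Unset Printing Implicit Defensive.

Import Order.TTheory GRing.Theory Num.Theory.
Import numFieldNormedType.Exports.

Local Open Scope classical_set_scope.
Local Open Scope ring_scope.

(** * Differentials and maps of class C^k *)

Section near_differential.
Context {R : realType} {V W : normedModType R}.

(** ['d] is a chosen differential, so that its dependence on the germ of the
function alone rests on the uniqueness of the differential. *)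
Lemma near_is_diff (f g : V -> W) (x : V) :
  (\forall y \near x, f y = g y) -> differentiable f x ->
  differentiable g x /\ (forall v, 'd g x v = 'd f x v).
Proof.
move=> fg /diff_locallyP[dfc dfx].
have expansion : g \o shift x = cst (g x) + 'd f x +o_ 0 id.
  apply/eqaddoP => _/posnumP[e].
  have /eqaddoP/(_ e%:num (gt0 e)) fe := dfx.
  have fg0 : \forall h \near 0, f (h + x) = g (h + x).
    by move: fg; rewrite (near_shift 0 x) /= subr0.
  near=> h.
  have -> : (g \o shift x - (cst (g x) + 'd f x)) h =
            (f \o shift x - (cst (f x) + 'd f x)) h.
    rewrite !fctE /= -(nbhs_singleton fg).
    by congr (_ - _); symmetry; near: h.
  by near: h.
have dg : 'd g x = 'd f x :> (V -> W) by exact: diff_unique.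
split; last by move=> v; exact: (congr1 (@^~ v) dg).
by apply/diff_locallyP; rewrite dg; split; [exact: dfc|exact: expansion].
Unshelve. all: by end_near. Qed.

Lemma diffDE (f g : V -> W) x v : differentiable f x -> differentiable g x ->
  'd (f + g) x v = 'd f x v + 'd g x v.
Proof. by move=> df dg; exact: (congr1 (@^~ v) (diffD df dg)). Qed.

Lemma diffME (f g : V -> R) x v : differentiable f x -> differentiable g x ->
  'd (f * g) x v = f x * 'd g x v + g x * 'd f x v.
Proof. by move=> df dg; exact: (congr1 (@^~ v) (diffM df dg)). Qed.

Lemma diff_compE (U : normedModType R) (f : U -> V) (g : V -> W) x v :
  differentiable f x -> differentiable g (f x) ->
  'd (g \o f) x v = 'd g (f x) ('d f x v).
Proof. by move=> df dg; exact: (congr1 (@^~ v) (diff_comp df dg)). Qed.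

Lemma diff_linE (L : {linear V -> W}) x v : continuous L -> 'd L x v = L v.
Proof. by move=> cL; exact: (congr1 (@^~ v) (diff_lin x cL)). Qed.

End near_differential.

Section simple_differentials.
Context {R : realType} {V W : normedModType R}.

Lemma diff_cstE (a : W) (x v : V) : 'd (cst a) x v = 0.
Proof. exact: (congr1 (@^~ v) (diff_cst a x)). Qed.

Lemma diff_idE (x v : V) : 'd id x v = v.
Proof. by apply: (@diff_linE R V V idfun) => ?. Qed.

Lemma differentiable_id (x : V) : differentiable id x.
Proof. by apply: (@linear_differentiable _ _ _ idfun) => ?. Qed.

End simple_differentials.

Section row_vectors.
Context {R : realType} {m : nat} {V : normedModType R}.
Implicit Type L : {linear 'rV[R]_m -> V}.

Lemma linear_row_expand L v : L v = \sum_j v 0 j *: L (delta_mx 0 j).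
Proof.
rewrite [in LHS](row_sum_delta v) linear_sum.
by apply: eq_bigr => j _; rewrite linearZ.
Qed.

Lemma linear_row_continuous L : continuous L.
Proof.
move=> x; apply: differentiable_continuous.
have -> : (L : 'rV[R]_m -> V) =
    \sum_(j < m) (fun v : 'rV[R]_m => v 0 j *: L (delta_mx 0 j)).
  by apply/funext => v; rewrite fct_sumE [LHS]linear_row_expand.
apply: differentiable_sum => j.
exact/differentiableZl/differentiable_coord.
Qed.

End row_vectors.

Definition row_entry {R : realType} {m : nat} (j : 'I_m) (v : 'rV[R]_m) : R := v 0 j.

Lemma row_entry_linear {R : realType} {m : nat} (j : 'I_m) :
  linear (@row_entry R m j).
Proof. by move=> a u v; rewrite /row_entry !mxE. Qed.

HB.instance Definition _ {R : realType} {m : nat} (j : 'I_m) :=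
  GRing.isLinear.Build R 'rV[R]_m R _ (@row_entry R m j) (row_entry_linear j).

Section class_C_closure.
Context {R : realType} {m : nat}.
Implicit Types (V W : normedModType R) (k : nat) (O : set 'rV[R]_m).

Lemma class_C_pred V k O (f : 'rV[R]_m -> V) : class_C k.+1 O f -> class_C k O f.
Proof.
elim: k f => [|k IH] f [df Df].
  by move=> x Ox; apply: differentiable_continuous; exact: df.
by split=> // v; apply: IH; exact: Df.
Qed.

Lemma class_C_subset V k O O' (f : 'rV[R]_m -> V) :
  O' `<=` O -> class_C k O f -> class_C k O' f.
Proof.
move=> sub; elim: k f => [|k IH] f; first by move=> Cf x /sub; exact: Cf.
by move=> [df Df]; split=> [x /sub|v]; [exact: df|exact/IH/Df].
Qed.

Lemma class_C_eq V k O (f g : 'rV[R]_m -> V) : open O ->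
  (forall x, O x -> f x = g x) -> class_C k O f -> class_C k O g.
Proof.
move=> oO; have near_eq (h h' : 'rV[R]_m -> V) x : (forall x, O x -> h x = h' x) -> O x ->
    \forall y \near x, h y = h' y.
  by move=> hh' Ox; near=> y; apply: hh'; near: y; exact: (open_nbhs_nbhs (conj oO Ox)).
elim: k f g => [|k IH] f g fg /=.
  move=> Cf x Ox; have nfg := near_eq _ _ _ fg Ox.
  apply: cvg_trans (near_eq_cvg nfg) _.
  by rewrite -(fg _ Ox); exact: Cf.
move=> [df Df]; split=> [x Ox|v].
  have [+ _] := near_is_diff (near_eq _ _ _ fg Ox) (df x Ox); exact.
apply: IH (Df v) => x Ox.
have [_ e] := near_is_diff (near_eq _ _ _ fg Ox) (df x Ox); exact: esym (e v).
Unshelve. all: by end_near. Qed.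

Lemma class_C_cst V k O (a : V) : class_C k O (cst a).
Proof.
elim: k a => [|k IH] a /=; first by move=> x _; exact: cst_continuous.
split=> [x _|v]; first exact: differentiable_cst.
have -> : (fun x => 'd (cst a : 'rV[R]_m -> V) x v) = cst 0.
  by apply/funext => x; rewrite diff_cst.
exact: IH.
Qed.

Lemma class_CD V k O (f g : 'rV[R]_m -> V) : open O ->
  class_C k O f -> class_C k O g -> class_C k O (f + g).
Proof.
move=> oO; elim: k f g => [|k IH] f g /=.
  by move=> Cf Cg x Ox; apply: continuousD; [exact: Cf|exact: Cg].
move=> [df Df] [dg Dg]; split=> [x Ox|v].
  by apply: differentiableD; [exact: df|exact: dg].
apply: class_C_eq (IH _ _ (Df v) (Dg v)) => // x Ox.
exact: esym (diffDE v (df x Ox) (dg x Ox)).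
Qed.

Lemma class_C_linear V W k O (L : {linear V -> W}) (f : 'rV[R]_m -> V) :
  open O -> continuous L -> class_C k O f -> class_C k O (L \o f).
Proof.
move=> oO cL; elim: k f => [|k IH] f /=.
  by move=> Cf x Ox; apply: continuous_comp; [exact: Cf|exact: cL].
move=> [df Df]; split=> [x Ox|v].
  by apply: differentiable_comp; [exact: df|exact: linear_differentiable].
apply: class_C_eq (IH _ (Df v)) => // x Ox.
rewrite diff_compE; [|exact: df|exact: linear_differentiable].
exact: esym (diff_linE _ _ cL).
Qed.

Lemma class_C_scale V k O (f : 'rV[R]_m -> R) (a : V) : open O ->
  class_C k O f -> class_C k O (fun x => f x *: a).
Proof.
pose L (r : R) := r *: a.
have linL : linear (L : R^o -> V) by move=> r u v; rewrite /L scalerDl scalerA.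
pose LM := GRing.isLinear.Build _ _ _ _ _ linL.
pose LL : {linear R^o -> V} := HB.pack L LM.
move=> oO Cf; apply: (@class_C_linear R V k O LL f) => //.
exact: scalel_continuous.
Qed.

Lemma class_CM k O (f g : 'rV[R]_m -> R) : open O ->
  class_C k O f -> class_C k O g -> class_C k O (f * g).
Proof.
move=> oO; elim: k f g => [|k IH] f g.
  by move=> Cf Cg x Ox; apply: continuousM; [exact: Cf|exact: Cg].
move=> Cf Cg; have [[df Df] [dg Dg]] := (Cf, Cg); split=> [x Ox|v].
  by apply: differentiableM; [exact: df|exact: dg].
apply: class_C_eq (class_CD oO (IH _ _ (class_C_pred Cf) (Dg v))
  (IH _ _ (class_C_pred Cg) (Df v))) => // x Ox.
exact: esym (diffME v (df x Ox) (dg x Ox)).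
Qed.

Lemma class_C_sum V k O n (f : 'I_n -> 'rV[R]_m -> V) : open O ->
  (forall i, class_C k O (f i)) -> class_C k O (\sum_i f i).
Proof.
move=> oO Cf; elim/big_ind : _ => //; first exact: class_C_cst.
by move=> g h; exact: class_CD.
Qed.

End class_C_closure.

Section smooth_germs.
Context {R : realType} {m : nat}.
Implicit Types (V W : normedModType R).

(** Germs of smooth maps: the open set of [class_Coo] is hidden, because it
shrinks at each operation. *)
Definition smooth_at V (x : 'rV[R]_m) (f : 'rV[R]_m -> V) :=
  exists A, [/\ open A, A x & class_Coo A f].

Lemma class_Coo_smooth_at V A (f : 'rV[R]_m -> V) x :
  open A -> class_Coo A f -> A x -> smooth_at x f.
Proof. by move=> oO Cf Ox; exists A. Qed.

Lemma smooth_at_near V x (f : 'rV[R]_m -> V) :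
  smooth_at x f -> \forall y \near x, smooth_at y f.
Proof.
move=> [A [oO Ox Cf]].
near=> y; exists A; split=> //.
by near: y; exact: (open_nbhs_nbhs (conj oO Ox)).
Unshelve. all: by end_near. Qed.

Lemma smooth_at_eq V x (f g : 'rV[R]_m -> V) :
  (\forall y \near x, f y = g y) -> smooth_at x f -> smooth_at x g.
Proof.
move=> fg [A [oO Ox Cf]].
exists (A `&` (fun y => f y = g y)^°); split.
- by apply: openI => //; exact: open_interior.
- by split.
- move=> k; apply: (@class_C_eq _ _ _ _ _ f).
  + by apply: openI => //; exact: open_interior.
  + by move=> y [_ /interior_subset].
  + by apply: class_C_subset (Cf k) => y [].
Qed.

Lemma smooth_at_diffble V x (f : 'rV[R]_m -> V) :
  smooth_at x f -> differentiable f x.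
Proof. by move=> [A [_ Ox /(_ 1%N) [+ _]]]; exact. Qed.

Lemma smooth_at_diff V x (f : 'rV[R]_m -> V) v :
  smooth_at x f -> smooth_at x (fun y => 'd f y v).
Proof. by move=> [A [oO Ox Cf]]; exists A; split=> // k; have [_] := Cf k.+1; exact. Qed.

Lemma smooth_at_cst V x (a : V) : smooth_at x (cst a).
Proof.
exists setT; split=> [| |k]; first exact: openT.
  by [].
exact: class_C_cst.
Qed.

Lemma smooth_atD V x (f g : 'rV[R]_m -> V) :
  smooth_at x f -> smooth_at x g -> smooth_at x (f + g).
Proof.
move=> [A [oO Ox Cf]] [B [oO' Ox' Cg]]; exists (A `&` B).
have oI : open (A `&` B) by exact: openI.
by split=> // k; apply: class_CD => //; [apply: class_C_subset (Cf k)|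
  apply: class_C_subset (Cg k)] => y [].
Qed.

Lemma smooth_atM x (f g : 'rV[R]_m -> R) :
  smooth_at x f -> smooth_at x g -> smooth_at x (f * g).
Proof.
move=> [A [oO Ox Cf]] [B [oO' Ox' Cg]]; exists (A `&` B).
have oI : open (A `&` B) by exact: openI.
by split=> // k; apply: class_CM => //; [apply: class_C_subset (Cf k)|
  apply: class_C_subset (Cg k)] => y [].
Qed.

Lemma smooth_at_linear V W x (L : {linear V -> W}) (f : 'rV[R]_m -> V) :
  continuous L -> smooth_at x f -> smooth_at x (L \o f).
Proof.
move=> cL [A [oO Ox Cf]]; exists A; split=> // k.
exact: class_C_linear.
Qed.

Lemma smooth_at_sum V n x (f : 'I_n -> 'rV[R]_m -> V) :
  (forall i, smooth_at x (f i)) -> smooth_at x (\sum_i f i).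
Proof.
move=> Cf; elim/big_ind : _ => //; first exact: smooth_at_cst.
by move=> g h; exact: smooth_atD.
Qed.

Lemma smooth_at_scale V x (f : 'rV[R]_m -> R) (a : V) :
  smooth_at x f -> smooth_at x (fun y => f y *: a).
Proof. by move=> [A [oO Ox Cf]]; exists A; split=> // k; exact: class_C_scale. Qed.

Lemma smooth_at_coord p x (f : 'rV[R]_m -> 'rV[R]_p) j :
  smooth_at x f -> smooth_at x (fun y => f y 0 j).
Proof.
apply: (@smooth_at_linear _ _ _ (row_entry j)).
exact: linear_row_continuous.
Qed.

Lemma smooth_at_coords p x (f : 'rV[R]_m -> 'rV[R]_p) :
  (forall j, smooth_at x (fun y => f y 0 j)) -> smooth_at x f.
Proof.
move=> Cf.
have -> : f = \sum_j (fun x => f x 0 j *: delta_mx 0 j).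
  by apply/funext => y; rewrite fct_sumE [LHS]row_sum_delta.
by apply: smooth_at_sum => j; exact: smooth_at_scale.
Qed.

End smooth_germs.

Lemma diff_coord {R : realType} {m p : nat} x (f : 'rV[R]_m -> 'rV[R]_p) j v :
  differentiable f x -> 'd (fun y => f y 0 j) x v = 'd f x v 0 j.
Proof.
have cL : continuous (@row_entry R p j) by exact: linear_row_continuous.
move=> df; have dL := linear_differentiable (f := @row_entry R p j) (f x) cL.
exact: etrans (diff_compE v df dL) (diff_linE _ _ cL).
Qed.

Section composition.
Context {R : realType} {m p : nat}.

Lemma class_C_comp k (O : set 'rV[R]_m) (O' : set 'rV[R]_p)
    (g : 'rV[R]_m -> 'rV[R]_p) (f : 'rV[R]_p -> R) :
  open O -> open O' -> (forall x, O x -> O' (g x)) ->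
  class_C k O g -> class_C k O' f -> class_C k O (f \o g).
Proof.
move=> oO oO' gO; elim: k f => [|k IH] f.
  by move=> Cg Cf x Ox; apply: continuous_comp; [exact: Cg|exact/Cf/gO].
move=> Cg Cf; have [[dg Dg] [df Df]] := (Cg, Cf); split=> [x Ox|v].
  by apply: differentiable_comp; [exact: dg|exact/df/gO].
apply: (@class_C_eq _ _ _ _ _ (\sum_j
   (fun x => 'd g x v 0 j) * ((fun y => 'd f y (delta_mx 0 j)) \o g))) => //.
  move=> x Ox; rewrite fct_sumE diff_compE; [|exact: dg|exact/df/gO].
  by rewrite [RHS]linear_row_expand.
apply: class_C_sum => // j; apply: class_CM => //.
  have [_ /(_ v) Dgv] := Cg.
  apply: (@class_C_linear _ _ _ _ _ _ (row_entry j) _ oO _ Dgv).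
  exact: linear_row_continuous.
by apply: IH; [exact: class_C_pred|exact: Df].
Qed.

Lemma smooth_at_comp x (g : 'rV[R]_m -> 'rV[R]_p) (f : 'rV[R]_p -> R) :
  smooth_at x g -> smooth_at (g x) f -> smooth_at x (f \o g).
Proof.
move=> sg [B [oO' Ox' Cf]]; have [A [oO Ox Cg]] := sg.
have gc : {for x, continuous g}.
  exact/differentiable_continuous/smooth_at_diffble.
exists (A `&` (g @^-1` B)^°).
have oI : open (A `&` (g @^-1` B)^°).
  by apply: openI => //; exact: open_interior.
split=> //.
  by split=> //; apply: gc; exact: (open_nbhs_nbhs (conj oO' Ox')).
move=> k; apply: (class_C_comp oI oO' _ _ (Cf k)).
  by move=> y [_ /interior_subset].
by apply: class_C_subset (Cg k) => y [].
Qed.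

Lemma smooth_at_compv q x (g : 'rV[R]_m -> 'rV[R]_p) (f : 'rV[R]_p -> 'rV[R]_q) :
  smooth_at x g -> smooth_at (g x) f -> smooth_at x (f \o g).
Proof.
move=> sg sf; apply: smooth_at_coords => j.
exact: (smooth_at_comp sg (smooth_at_coord j sf)).
Qed.

Lemma smooth_at_diff_apply x (g w : 'rV[R]_m -> 'rV[R]_p) (f : 'rV[R]_p -> R) :
  smooth_at x g -> smooth_at x w -> smooth_at (g x) f ->
  smooth_at x (fun y => 'd f (g y) (w y)).
Proof.
move=> sg sw sf.
have -> : (fun y => 'd f (g y) (w y)) =
    \sum_j (fun y => w y 0 j) * ((fun z => 'd f z (delta_mx 0 j)) \o g).
  by apply/funext => y; rewrite fct_sumE [LHS]linear_row_expand.
apply: smooth_at_sum => j; apply: smooth_atM; first exact: smooth_at_coord.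
by apply: smooth_at_comp => //; exact: smooth_at_diff.
Qed.

Lemma smooth_at_diff_applyv q x (g w : 'rV[R]_m -> 'rV[R]_p)
    (f : 'rV[R]_p -> 'rV[R]_q) :
  smooth_at x g -> smooth_at x w -> smooth_at (g x) f ->
  smooth_at x (fun y => 'd f (g y) (w y)).
Proof.
move=> sg sw sf; apply: smooth_at_coords => j.
apply: (@smooth_at_eq _ _ _ _ (fun y => 'd (fun z => f z 0 j) (g y) (w y))).
  have gc : {for x, continuous g}.
    exact/differentiable_continuous/smooth_at_diffble.
  have nsf : \forall y \near x, smooth_at (g y) f by exact: (gc _ (smooth_at_near sf)).
  near=> y; rewrite diff_coord //; apply: smooth_at_diffble.
  by near: y; exact: nsf.
by apply: smooth_at_diff_apply => //; exact: smooth_at_coord.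
Unshelve. all: by end_near. Qed.

End composition.

Section schwarz.
Context {R : realType} {m : nat}.
Implicit Types (f : 'rV[R]_m -> R) (x v w : 'rV[R]_m).

Lemma is_derive_line f x v (t : R) : differentiable f (x + t *: v) ->
  is_derive t 1 (fun s : R => f (x + s *: v)) ('d f (x + t *: v) v).
Proof.
move=> df.
have e : (fun h : R => h^-1 *: (((fun s : R => f (x + s *: v)) \o shift t) (h *: 1)
            - f (x + t *: v))) =
         (fun h : R => h^-1 *: ((f \o shift (x + t *: v)) (h *: v) - f (x + t *: v))).
  apply/funext => h /=; congr (_ *: (f _ - _)).
  by rewrite addrCA -scalerDl; congr (_ + _ *: _); rewrite /GRing.scale /= mulr1.
have dv : derivable f (x + t *: v) v by exact: diff_derivable.
apply: DeriveDef; first by rewrite /derivable e.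
by rewrite -deriveE // /derive e.
Qed.

Lemma MVT_line f x v (h : R) : 0 < h ->
  (forall t, 0 <= t <= h -> differentiable f (x + t *: v)) ->
  exists2 t, 0 <= t <= h & f (x + h *: v) - f x = h * 'd f (x + t *: v) v.
Proof.
move=> h0 df; pose g (s : R) := f (x + s *: v).
have dg s : s \in `[0, h] -> is_derive s 1 g ('d f (x + s *: v) v).
  by rewrite in_itv /= => sh; apply: is_derive_line; exact: df.
have cg : {within `[0, h], continuous g}.
  apply: continuous_in_subspaceT => s; rewrite inE /= => sh.
  apply: differentiable_continuous; apply/derivable1_diffP.
  by have [] := dg s sh.
have dg' s : s \in `]0, h[%R -> is_derive s 1 g ('d f (x + s *: v) v).
  move=> sh; exact: (dg s (subset_itv_oo_cc sh)).
have [t th e] := MVT h0 dg' cg.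
exists t; first by move: th; rewrite in_itv /= => /andP[/ltW-> /ltW->].
by move: e; rewrite /g scale0r addr0 subr0 mulrC.
Qed.

Lemma MVT_two_lines f x y v (h : R) : 0 < h ->
  (forall t, 0 <= t <= h -> differentiable f (x + t *: v)) ->
  (forall t, 0 <= t <= h -> differentiable f (y + t *: v)) ->
  exists2 t, 0 <= t <= h & (f (x + h *: v) - f (y + h *: v)) - (f x - f y) =
    h * ('d f (x + t *: v) v - 'd f (y + t *: v) v).
Proof.
move=> h0 dfx dfy.
pose gx (s : R) := f (x + s *: v); pose gy (s : R) := f (y + s *: v).
pose g : R -> R := gx - gy.
have dg s : 0 <= s <= h -> is_derive s 1 g ('d f (x + s *: v) v - 'd f (y + s *: v) v).
  by move=> sh; apply: is_deriveB; apply: is_derive_line; [exact: dfx|exact: dfy].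
have cg : {within `[0, h], continuous g}.
  apply: continuous_in_subspaceT => s; rewrite inE /= => sh.
  apply: differentiable_continuous; apply/derivable1_diffP.
  by have [] := dg s sh.
have dg' s : s \in `]0, h[%R ->
    is_derive s 1 g ('d f (x + s *: v) v - 'd f (y + s *: v) v).
  by move=> sh; apply: dg; have := subset_itv_oo_cc sh; rewrite inE.
have [t th e] := MVT h0 dg' cg.
exists t; first by move: th; rewrite in_itv /= => /andP[/ltW-> /ltW->].
by move: e; rewrite /g !fctE /gx /gy !scale0r !addr0 subr0 mulrC.
Qed.

(** The mean value theorem is applied twice: along v to the difference of f on
two parallel segments, then along w to the function y |-> 'd f y v. *)
Lemma second_difference f x v w (A : set 'rV[R]_m) (e : R) : 0 < e ->
  open A -> A x -> class_C 2 A f ->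
  \forall h \near 0^'+,
    `|h ^- 2 * (f (x + h *: v + h *: w) - f (x + h *: v) - (f (x + h *: w) - f x))
      - 'd (fun y => 'd f y v) x w| < e.
Proof.
move=> e0 oA Ax [df D2f]; have [d2f cf] := D2f v.
have /cvgrPdist_lt/(_ e e0) cG := cf w x Ax.
have /nbhs_ballP[d /= d0 dA] : \forall y \near x, A y /\
    `|'d (fun y => 'd f y v) x w - 'd (fun y => 'd f y v) y w| < e.
  by apply: filterI => //; exact: (open_nbhs_nbhs (conj oA Ax)).
near=> h.
have h0 : 0 < h by near: h; exact: nbhs_right_gt.
have inball s t : 0 <= s <= h -> 0 <= t <= h -> ball x d (x + s *: v + t *: w).
  move=> /andP[s0 sh] /andP[t0 th].
  rewrite -ball_normE /= -addrA opprD addNKr normrN.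
  apply: (@le_lt_trans _ _ (h * (`|v| + `|w|))).
    rewrite (le_trans (ler_normD _ _)) // mulrDr !normrZ !ger0_norm //.
    by rewrite lerD // ler_wpM2r.
  have vw0 : 0 < `|v| + `|w| + 1 by rewrite ltr_wpDl // addr_ge0.
  apply: (@le_lt_trans _ _ (h * (`|v| + `|w| + 1))).
    by rewrite ler_wpM2l ?lerDl ?(ltW h0) //.
  rewrite -ltr_pdivlMr //; near: h; apply: nbhs_right_lt; exact: divr_gt0.
have zero_itv : 0 <= (0 : R) <= h by rewrite lexx ltW.
have h_itv : 0 <= h <= h by rewrite lexx ltW.
have [||s sh Es] := @MVT_two_lines f (x + h *: w) x v h h0.
- move=> t th; apply: df; rewrite addrAC.
  by have [] := dA _ (inball t h th h_itv).
- move=> t th; apply: df.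
  by have [] := dA _ (inball t 0 th zero_itv); rewrite scale0r addr0.
have [|t th Et] := @MVT_line (fun y => 'd f y v) (x + s *: v) w h h0.
  by move=> t th; apply: d2f; have [] := dA _ (inball s t sh th).
have -> : f (x + h *: v + h *: w) - f (x + h *: v) - (f (x + h *: w) - f x) =
    h ^+ 2 * 'd (fun y => 'd f y v) (x + s *: v + t *: w) w.
  rewrite [x + h *: v + h *: w]addrAC [LHS]Es [x + h *: w + s *: v]addrAC.
  by rewrite [X in h * X]Et mulrA -expr2.
rewrite mulrA mulVf ?mul1r ?expf_neq0 ?gt_eqF //.
by rewrite distrC; have [] := dA _ (inball s t sh th).
Unshelve. all: by end_near. Qed.

(** Both sides are limits of the same second difference quotient, which is
symmetric in v and w. *)
Lemma diff_diffC f x v w (A : set 'rV[R]_m) : open A -> A x -> class_C 2 A f ->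
  'd (fun y => 'd f y v) x w = 'd (fun y => 'd f y w) x v.
Proof.
move=> oA Ax C2f.
pose a : R := 'd (fun y => 'd f y v) x w; pose b : R := 'd (fun y => 'd f y w) x v.
change (a = b); apply/eqP; rewrite -subr_eq0 -normr_le0; apply/ler_addgt0Pr => e e0.
have e20 : 0 < e / 2 by rewrite divr_gt0.
near ((0 : R)^'+) => h.
have Hvw : `|h ^- 2 * (f (x + h *: v + h *: w) - f (x + h *: v) - (f (x + h *: w) - f x))
      - a| < e / 2.
  by near: h; exact: (second_difference v w e20 oA Ax C2f).
have Hwv : `|h ^- 2 * (f (x + h *: w + h *: v) - f (x + h *: w) - (f (x + h *: v) - f x))
      - b| < e / 2.
  by near: h; exact: (second_difference w v e20 oA Ax C2f).
move: Hvw Hwv; rewrite [x + h *: w + h *: v]addrAC.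
have -> : f (x + h *: v + h *: w) - f (x + h *: w) - (f (x + h *: v) - f x) =
  f (x + h *: v + h *: w) - f (x + h *: v) - (f (x + h *: w) - f x) by ring.
set D := _ * _ => Da Db.
have -> : a - b = (D - b) - (D - a) by ring.
rewrite (le_trans (ler_normB _ _)) // add0r ltW // [ltRHS]splitr ltrD //.
Unshelve. all: by end_near. Qed.

End schwarz.

Lemma smooth_at_class_C {R : realType} {m : nat} (V : normedModType R)
    (A : set 'rV[R]_m) (f : 'rV[R]_m -> V) :
  (forall x, A x -> smooth_at x f) -> class_Coo A f.
Proof.
move=> + k; elim: k f => [|k IH] f sf /=.
  by move=> x /sf/smooth_at_diffble/differentiable_continuous.
split=> [x /sf/smooth_at_diffble //|v].
by apply: IH => x /sf; exact: smooth_at_diff.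
Qed.

Lemma smooth_at_id {R : realType} {m : nat} (x : 'rV[R]_m) : smooth_at x id.
Proof.
apply: smooth_at_coords => j; apply: smooth_at_coord.
exists setT; split=> //; first exact: openT.
elim=> [y _|k IH] /=; first by [].
split=> [y _|v]; first exact: differentiable_id.
apply: (@class_C_eq _ _ _ _ _ (cst v)); [exact: openT| |exact: class_C_cst].
by move=> y _; rewrite diff_idE.
Qed.

(** The product rule for the pairing of the covector 'd f with the vector w, in
coordinates. *)
Lemma diff_diff_apply {R : realType} {m : nat} (f : 'rV[R]_m -> R)
    (w : 'rV[R]_m -> 'rV[R]_m) (x v : 'rV[R]_m) :
  smooth_at x f -> smooth_at x w ->
  'd (fun u => 'd f u (w u)) x v =
  'd (fun u => 'd f u (w x)) x v + 'd f x ('d w x v).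
Proof.
move=> sf sw.
have expand (h : 'rV[R]_m -> 'rV[R]_m) : smooth_at x h ->
    'd (fun u => 'd f u (h u)) x v =
    \sum_j (h x 0 j * 'd (fun u => 'd f u (delta_mx 0 j)) x v
            + 'd f x (delta_mx 0 j) * 'd h x v 0 j).
  move=> sh; pose F j : 'rV[R]_m -> R :=
    (fun u => h u 0 j) * (fun u => 'd f u (delta_mx 0 j)).
  have hF : (fun u => 'd f u (h u)) = \sum_j F j.
    by apply/funext => u; rewrite fct_sumE [LHS]linear_row_expand.
  have sF j : smooth_at x (F j).
    by apply: smooth_atM; [exact: smooth_at_coord|exact: smooth_at_diff].
  have dsum : 'd (\sum_j F j) x v = \sum_j 'd (F j) x v.
    suff: forall s : seq 'I_m, smooth_at x (\sum_(j <- s) F j) /\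
        'd (\sum_(j <- s) F j) x v = \sum_(j <- s) 'd (F j) x v.
      by move=> /(_ (index_enum _)) [].
    elim=> [|j s [sS IH]].
      rewrite !big_nil; split; first exact: smooth_at_cst.
      exact: diff_cstE.
    rewrite !big_cons; split; first exact: smooth_atD.
    apply: etrans (congr1 _ IH).
    by apply: diffDE; exact: smooth_at_diffble.
  apply: etrans (congr1 (fun G : 'rV[R]_m -> R => 'd G x v) hF) _.
  apply: etrans dsum _; apply: eq_bigr => j _.
  have d1 : differentiable (fun u => h u 0 j) x.
    exact/smooth_at_diffble/smooth_at_coord.
  have d2 : differentiable (fun u => 'd f u (delta_mx 0 j)) x.
    exact/smooth_at_diffble/smooth_at_diff.
  apply: etrans (diffME v d1 d2) _; congr (_ + _ * _).
  by apply: diff_coord; exact: smooth_at_diffble.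
apply: etrans (expand w sw) _.
have frozen : 'd (fun u => 'd f u (w x)) x v =
  \sum_j (w x 0 j * 'd (fun u => 'd f u (delta_mx 0 j)) x v).
  apply: etrans (expand (cst (w x)) (smooth_at_cst _ _)) _.
  apply: eq_bigr => j _.
  have -> : 'd (cst (w x)) x v = 0 by exact: diff_cstE.
  by rewrite mxE mulr0 addr0.
rewrite big_split /=; apply: etrans (congr1 (+%R^~ _) (esym frozen)) _.
congr (_ + _); apply: esym; apply: etrans (linear_row_expand _ _) _; apply: eq_bigr => j _.
by rewrite mulrC.
Qed.

(** * Smooth atlases *)

Section atlas.
Context {R : realType} {m : nat} (N : charted R m).

Definition smooth_atlas : Prop :=
  [/\ (forall p : N, dom (chart_at p) p),
      (forall (c : chart N) (p : N), dom c p -> param c (coord c p) = p) &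
      (forall c c' : chart N,
         open (coord c @` (dom c `&` dom c')) /\
         class_Coo (coord c @` (dom c `&` dom c')) (coord c' \o param c))].

Lemma smooth_manifold_atlas : smooth_manifold N -> smooth_atlas.
Proof. by case. Qed.

(** The neighbourhood filter of p, read in the preferred chart at p. By
[at_pt_chart] and [at_ptP], every chart around p, as well as the topology of the
atlas, gives the same filter. *)
Definition at_pt (p : N) : set_system N :=
  param (chart_at p) @ nbhs (coord (chart_at p) p).

Global Instance at_pt_filter p : Filter (at_pt p).
Proof. by rewrite /at_pt; typeclasses eauto. Qed.

Hypothesis hN : smooth_atlas.
Implicit Types (p q : N) (c : chart N) (f g : N -> R) (X Y Z : vfield N).

Lemma dom_chart_at p : dom (chart_at p) p. Proof. by have [] := hN. Qed.

Lemma coordK c p : dom c p -> param c (coord c p) = p.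
Proof. by have [_ + _] := hN; exact. Qed.

Lemma near_transition c c' p : dom c p -> dom c' p ->
  \forall u \near coord c p, [/\ dom c (param c u), dom c' (param c u)
    & coord c (param c u) = u].
Proof.
move=> cp c'p; have [_ _ /(_ c c') [oA _]] := hN.
apply: filterS (open_nbhs_nbhs (conj oA _)); last by exists p.
by move=> u /= [q [cq c'q] <-]; rewrite coordK.
Qed.

Lemma smooth_transition c c' p : dom c p -> dom c' p ->
  smooth_at (coord c p) (coord c' \o param c).
Proof.
move=> cp c'p; have [_ _ /(_ c c') [oA CA]] := hN.
by apply: class_Coo_smooth_at oA CA _; exists p.
Qed.

Lemma at_pt_chart c p (P : set N) : dom c p ->
  at_pt p P <-> \forall u \near coord c p, P (param c u).
Proof.
have change c1 c2 : dom c1 p -> dom c2 p ->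
    (\forall u \near coord c1 p, P (param c1 u)) ->
    \forall u \near coord c2 p, P (param c2 u).
  move=> c1p c2p H.
  have cont : {for coord c2 p, continuous (coord c1 \o param c2)}.
    exact/differentiable_continuous/smooth_at_diffble/smooth_transition.
  have H' : \forall u \near coord c2 p, P (param c1 ((coord c1 \o param c2) u)).
    have H0 : nbhs ((coord c1 \o param c2) (coord c2 p)) (fun u => P (param c1 u)).
      by rewrite /= coordK.
    exact: (cont _ H0).
  apply: filterS2 H' (near_transition c2p c1p) => u /= + [_ c1u _].
  by rewrite coordK.
move=> cp; split; apply: change => //; exact: dom_chart_at.
Qed.

Lemma at_pt_self p (P : set N) : at_pt p P -> P p.
Proof.
by move=> /nbhs_singleton; rewrite /preimage /= coordK //; exact: dom_chart_at.
Qed.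

Lemma at_pt_near p (P : set N) : at_pt p P -> at_pt p (fun q => at_pt q P).
Proof.
have cp := dom_chart_at p; move=> /(nbhs_interior) H.
apply: filterS2 H (near_transition cp cp) => u Hu [cu _ uK].
by apply/(at_pt_chart _ cu); rewrite uK.
Qed.

Lemma at_pt_dom c p : dom c p -> at_pt p (dom c).
Proof.
move=> cp; apply/(at_pt_chart _ cp).
by apply: filterS (near_transition cp cp) => u [].
Qed.

Lemma open_in_at_pt (W : set N) : open_in W <-> (forall p, W p -> at_pt p W).
Proof.
split=> [oW p Wp|H c].
  have cp := dom_chart_at p.
  apply/(at_pt_chart _ cp); apply: filterS (open_nbhs_nbhs (conj (oW (chart_at p)) _)).
    by move=> u /= [q [Wq cq] <-]; rewrite coordK.
  by exists p.
rewrite openE => _ [p [Wp cp] <-]; rewrite /interior.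
have /(at_pt_chart _ cp) WW := H p Wp.
apply: filterS2 WW (near_transition cp cp) => u Wu [cu _ uK].
by exists (param c u).
Qed.

Lemma open_in_near (W : set N) p : open_in W -> W p -> at_pt p W.
Proof. by move=> /open_in_at_pt; apply. Qed.

Lemma at_ptP p (P : set N) :
  at_pt p P <-> exists W, [/\ open_in W, W p & forall q, W q -> P q].
Proof.
split=> [H|[W [oW Wp WP]]].
  exists (fun q => at_pt q P); split=> //.
    by apply/open_in_at_pt => q; exact: at_pt_near.
  by move=> q; exact: at_pt_self.
exact: filterS WP (open_in_near oW Wp).
Qed.

Lemma germ_eqP p X Y : germ_eq p X Y <-> \forall q \near at_pt p, X q = Y q.
Proof. by rewrite /germ_eq; symmetry; exact: at_ptP. Qed.

Lemma diff_change (V : normedModType R) (f : N -> V) c c' p v :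
  dom c p -> dom c' p -> differentiable (f \o param c') (coord c' p) ->
  differentiable (f \o param c) (coord c p) /\
  'd (f \o param c) (coord c p) v =
  'd (f \o param c') (coord c' p) ('d (coord c' \o param c) (coord c p) v).
Proof.
move=> cp c'p df.
have dt := smooth_at_diffble (smooth_transition cp c'p).
have e : (coord c' \o param c) (coord c p) = coord c' p by rewrite /= coordK.
have df' : differentiable (f \o param c') ((coord c' \o param c) (coord c p)).
  by rewrite e.
have E : \forall u \near coord c p,
    ((f \o param c') \o (coord c' \o param c)) u = (f \o param c) u.
  by apply: filterS (near_transition cp c'p) => u [_ c'u _]; rewrite /= coordK.
have [d1 d2] := near_is_diff E (differentiable_comp dt df').
split; first exact: d1.
apply: etrans (d2 v) _; apply: etrans (diff_compE v dt df') _.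
exact: (congr1 (fun x => 'd (f \o param c') x _) e).
Qed.

Lemma diff_transition c c' c'' p v : dom c p -> dom c' p -> dom c'' p ->
  'd (coord c'' \o param c) (coord c p) v =
  'd (coord c'' \o param c') (coord c' p) ('d (coord c' \o param c) (coord c p) v).
Proof.
move=> cp c'p c''p; have [] // := @diff_change _ (coord c'') c c' p v cp c'p.
exact/smooth_at_diffble/smooth_transition.
Qed.

Lemma diff_transition_self c p v : dom c p ->
  'd (coord c \o param c) (coord c p) v = v.
Proof.
move=> cp.
have E : \forall u \near coord c p, id u = (coord c \o param c) u.
  by apply: filterS (near_transition cp cp) => u [_ _].
have [_ d] := near_is_diff E (differentiable_id _).
exact: etrans (d v) (diff_idE _ _).
Qed.

Lemma components_change c c' p xi : dom c p -> dom c' p ->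
  components c' p xi = 'd (coord c' \o param c) (coord c p) (components c p xi).
Proof. by move=> cp c'p; apply: diff_transition => //; exact: dom_chart_at. Qed.

Lemma components_chart_at p xi : components (chart_at p) p xi = xi.
Proof. exact/diff_transition_self/dom_chart_at. Qed.

(** The inverse of [components c p] in each fibre: the coordinate field with
constant components xi in the chart c. *)
Definition chart_field c (xi : 'rV[R]_m) : vfield N := fun p =>
  'd (coord (chart_at p) \o param c) (coord c p) xi.

Lemma components_chart_field c xi p : dom c p ->
  components c p (chart_field c xi p) = xi.
Proof.
move=> cp; have p0 := dom_chart_at p.
by rewrite /components -diff_transition // diff_transition_self.
Qed.

Lemma chart_field_components c p xi : dom c p ->
  chart_field c (components c p xi) p = xi.
Proof.
move=> cp; have p0 := dom_chart_at p.
by rewrite /chart_field -diff_transition // diff_transition_self.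
Qed.

(** One chart is enough to test smoothness, since transition maps are smooth. *)
Lemma smooth_function_nearP c p f : dom c p ->
  smooth_function_near p f <-> smooth_at (coord c p) (f \o param c).
Proof.
move=> cp; split=> [[W [oW Wp CW]]|sf].
  exists (coord c @` (W `&` dom c)); split=> //; first by exists p.
  by move=> k; exact: CW.
have nf := smooth_at_near sf.
have E : at_pt p (fun q => dom c q /\ smooth_at (coord c q) (f \o param c)).
  apply/(at_pt_chart _ cp); apply: filterS2 nf (near_transition cp cp).
  by move=> u su [cu _ uK]; rewrite uK.
have [W [oW Wp WP]] := (at_ptP _ _).1 E.
exists W; split=> // k c'; apply: smooth_at_class_C => _ [q [Wq c'q] <-].
have [cq sq] := WP q Wq.
have st := smooth_transition c'q cq.
have := @smooth_at_comp _ _ _ _ _ (f \o param c) st; rewrite /= coordK // => /(_ sq).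
apply: smooth_at_eq.
by apply: filterS (near_transition c'q cq) => u [_ cu _]; rewrite /= coordK.
Qed.

Lemma smooth_nearP c p X : dom c p ->
  smooth_near p X <-> smooth_at (coord c p) (local_rep c X).
Proof.
move=> cp; split=> [[W [oW Wp CW]]|sX].
  by exists (coord c @` (W `&` dom c)); split=> //; exists p.
have nX := smooth_at_near sX.
have E : at_pt p (fun q => dom c q /\ smooth_at (coord c q) (local_rep c X)).
  apply/(at_pt_chart _ cp); apply: filterS2 nX (near_transition cp cp).
  by move=> u su [cu _ uK]; rewrite uK.
have [W [oW Wp WP]] := (at_ptP _ _).1 E.
exists W; split=> // c'; apply: smooth_at_class_C => _ [q [Wq c'q] <-].
have [cq sq] := WP q Wq.
have st := smooth_transition c'q cq.
have st' := smooth_transition cq c'q.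
apply: (@smooth_at_eq _ _ _ _ (fun u => 'd (coord c' \o param c)
   ((coord c \o param c') u) ((local_rep c X \o (coord c \o param c')) u))).
  apply: filterS (near_transition c'q cq) => u [c'u cu uK] /=.
  by rewrite /local_rep /= coordK // [RHS](components_change _ cu c'u).
apply: smooth_at_diff_applyv => //; last by rewrite /= coordK.
by apply: smooth_at_compv => //=; rewrite coordK.
Qed.

Lemma smooth_near_near p X : smooth_near p X -> at_pt p (fun q => smooth_near q X).
Proof.
move=> [W [oW Wp CW]]; apply/at_ptP; exists W; split=> // q Wq.
by exists W.
Qed.

Lemma smooth_function_near_near p f :
  smooth_function_near p f -> at_pt p (fun q => smooth_function_near q f).
Proof.
move=> [W [oW Wp CW]]; apply/at_ptP; exists W; split=> // q Wq.
by exists W.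
Qed.

Lemma smooth_near_eq p X Y : (\forall q \near at_pt p, X q = Y q) ->
  smooth_near p X -> smooth_near p Y.
Proof.
have cp := dom_chart_at p.
move=> /(at_pt_chart _ cp) XY /(smooth_nearP _ cp) sX; apply/(smooth_nearP _ cp).
apply: smooth_at_eq sX; apply: filterS XY => u XY.
by rewrite /local_rep XY.
Qed.

Lemma smooth_function_near_eq p f g : (\forall q \near at_pt p, f q = g q) ->
  smooth_function_near p f -> smooth_function_near p g.
Proof.
have cp := dom_chart_at p.
move=> /(at_pt_chart _ cp) fg /(smooth_function_nearP _ cp) sf.
by apply/(smooth_function_nearP _ cp); exact: smooth_at_eq sf.
Qed.

Lemma smooth_function_cst p (a : R) : smooth_function_near p (fun=> a).
Proof. apply/(smooth_function_nearP _ (dom_chart_at p)); exact: smooth_at_cst. Qed.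

Lemma smooth_functionD p f g : smooth_function_near p f ->
  smooth_function_near p g -> smooth_function_near p (fun q => f q + g q).
Proof.
have cp := dom_chart_at p.
by move=> /(smooth_function_nearP _ cp) + /(smooth_function_nearP _ cp) +;
  move=> sf sg; apply/(smooth_function_nearP _ cp); exact: smooth_atD.
Qed.

Lemma smooth_functionM p f g : smooth_function_near p f ->
  smooth_function_near p g -> smooth_function_near p (fun q => f q * g q).
Proof.
have cp := dom_chart_at p.
by move=> /(smooth_function_nearP _ cp) + /(smooth_function_nearP _ cp) +;
  move=> sf sg; apply/(smooth_function_nearP _ cp); exact: smooth_atM.
Qed.

End atlas.

(** * Vector fields as derivations *)

Section fields.
Context {R : realType} {m : nat} (N : charted R m).
Hypothesis hN : smooth_atlas N.
Implicit Types (p q : N) (c : chart N) (f g : N -> R) (X Y Z : vfield N).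

(** The preferred chart at p varies with p without any continuity, so that
derivatives of [act X f] can only be computed after it is read in a fixed chart. *)
Lemma act_chart c p f X : dom c p -> smooth_function_near p f ->
  act X f p = 'd (f \o param c : 'rV[R]_m -> R) (coord c p) (components c p (X p)).
Proof.
move=> cp sf; have p0 := dom_chart_at hN p.
have /(smooth_function_nearP hN _ cp)/smooth_at_diffble df := sf.
by have [] := diff_change hN (X p) p0 cp df.
Qed.

Lemma near_act_chart c p f X : dom c p -> smooth_function_near p f ->
  \forall u \near coord c p, act X f (param c u) =
    'd (f \o param c : 'rV[R]_m -> R) u (local_rep c X u).
Proof.
move=> cp /(smooth_function_near_near hN)/(at_pt_chart hN _ cp) sf.
apply: filterS2 sf (near_transition hN cp cp) => u sf [cu _ uK].
by rewrite (act_chart _ cu sf) uK.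
Qed.

Lemma smooth_act p f X : smooth_near p X -> smooth_function_near p f ->
  smooth_function_near p (act X f).
Proof.
have cp := dom_chart_at hN p; move=> sX sf.
have nA : \forall u \near coord (chart_at p) p,
    'd (f \o param (chart_at p) : 'rV[R]_m -> R) u (local_rep (chart_at p) X u) =
    (act X f \o param (chart_at p)) u.
  by apply: filterS (near_act_chart X cp sf) => u /esym.
apply/(smooth_function_nearP hN _ cp); apply: (smooth_at_eq nA).
apply: (@smooth_at_diff_apply _ _ _ _ id); first exact: smooth_at_id.
  exact/(smooth_nearP hN _ cp).
exact/(smooth_function_nearP hN _ cp).
Qed.

Lemma act_eq p f g X : (\forall q \near at_pt p, f q = g q) ->
  smooth_function_near p f -> act X f p = act X g p.
Proof.
have cp := dom_chart_at hN p.
move=> /(at_pt_chart hN _ cp) fg /(smooth_function_nearP hN _ cp) sf.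
have [_ e] := near_is_diff fg (smooth_at_diffble sf).
exact: esym (e _).
Qed.

Lemma act_cst p X (a : R) : act X (fun=> a) p = 0.
Proof. exact: diff_cstE. Qed.

Lemma actD p X f g : smooth_function_near p f -> smooth_function_near p g ->
  act X (fun q => f q + g q) p = act X f p + act X g p.
Proof.
have cp := dom_chart_at hN p.
move=> /(smooth_function_nearP hN _ cp) sf /(smooth_function_nearP hN _ cp) sg.
exact: diffDE (smooth_at_diffble sf) (smooth_at_diffble sg).
Qed.

Lemma actM p X f g : smooth_function_near p f -> smooth_function_near p g ->
  act X (fun q => f q * g q) p = f p * act X g p + g p * act X f p.
Proof.
have cp := dom_chart_at hN p.
move=> /(smooth_function_nearP hN _ cp) sf /(smooth_function_nearP hN _ cp) sg.
have := diffME (X p) (smooth_at_diffble sf) (smooth_at_diffble sg).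
by rewrite /= coordK.
Qed.

Lemma actZ p X f (a : R) : smooth_function_near p f ->
  act X (fun q => a * f q) p = a * act X f p.
Proof.
move=> sf; rewrite actM //; last exact: (smooth_function_cst hN).
by rewrite act_cst mulr0 addr0.
Qed.

Lemma act_vadd X Y f p : act (vadd X Y) f p = act X f p + act Y f p.
Proof. by rewrite /act /vadd linearD. Qed.

Lemma act_vopp X f p : act (vopp X) f p = - act X f p.
Proof. by rewrite /act /vopp linearN. Qed.

Lemma act_vscale X f g p : act (vscale g X) f p = g p * act X f p.
Proof. by rewrite /act /vscale linearZ. Qed.

Lemma act0 X f p : X p = 0 -> act X f p = 0.
Proof. by rewrite /act => ->; rewrite linear0. Qed.

Definition coord_fun c (j : 'I_m) : N -> R := fun q => coord c q 0 j.

Lemma coord_fun_near c p j : dom c p ->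
  \forall u \near coord c p, (u : 'rV[R]_m) 0 j = (coord_fun c j \o param c) u.
Proof.
move=> cp; apply: filterS (near_transition hN cp cp) => u [_ _ uK].
by rewrite /coord_fun /= uK.
Qed.

Lemma smooth_coord_fun c p j : dom c p -> smooth_function_near p (coord_fun c j).
Proof.
move=> cp; apply/(smooth_function_nearP hN _ cp).
by apply: smooth_at_eq (coord_fun_near j cp) _; apply: smooth_at_coord; exact: smooth_at_id.
Qed.

Lemma act_coord_fun c p X j : dom c p ->
  act X (coord_fun c j) p = components c p (X p) 0 j.
Proof.
move=> cp; rewrite (act_chart _ cp) //; last exact: smooth_coord_fun.
have := near_is_diff (coord_fun_near j cp) (differentiable_coord _ _ _).
move=> [_ e]; apply: etrans (e _) _.
apply: etrans (diff_coord _ _ (differentiable_id _)) _.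
by rewrite diff_idE.
Qed.

(** The j-th component of X in the chart c is X(x_j): the smoothness of a field,
in particular of a bracket, is that of functions. *)
Lemma smooth_near_act c p X : dom c p ->
  (forall j, smooth_function_near p (act X (coord_fun c j))) -> smooth_near p X.
Proof.
move=> cp sX; apply/(smooth_nearP hN _ cp); apply: smooth_at_coords => j.
have /(smooth_function_nearP hN _ cp) := sX j; apply: smooth_at_eq.
apply: filterS (near_transition hN cp cp) => u [cu _ uK] /=.
by rewrite act_coord_fun.
Qed.

(** Tested on coordinate functions. Identities between vector fields are thereby
reduced to identities between derivations. *)
Lemma vector_eq p X Y :
  (forall f, smooth_function_near p f -> act X f p = act Y f p) -> X p = Y p.
Proof.
move=> XY; have cp := dom_chart_at hN p; apply/rowP => j.
have := XY _ (smooth_coord_fun j cp).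
by rewrite !act_coord_fun // !components_chart_at.
Qed.

Lemma smooth_components c p X j : dom c p -> smooth_near p X ->
  smooth_function_near p (fun q => components c q (X q) 0 j).
Proof.
move=> cp sX; apply: (smooth_function_near_eq hN _ (smooth_act sX (smooth_coord_fun j cp))).
by apply: filterS (at_pt_dom hN cp) => q cq; rewrite act_coord_fun.
Qed.

Lemma smooth_vadd p X Y : smooth_near p X -> smooth_near p Y -> smooth_near p (vadd X Y).
Proof.
move=> sX sY; have cp := dom_chart_at hN p; apply: (smooth_near_act cp) => j.
have sf := smooth_coord_fun j cp.
have -> : act (vadd X Y) (coord_fun (chart_at p) j) =
    (fun q => act X (coord_fun (chart_at p) j) q + act Y (coord_fun (chart_at p) j) q).
  by apply/funext => q; exact: act_vadd.
by apply: (smooth_functionD hN); exact: smooth_act.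
Qed.

Lemma smooth_vscale p f X : smooth_function_near p f -> smooth_near p X ->
  smooth_near p (vscale f X).
Proof.
move=> sf sX; have cp := dom_chart_at hN p; apply: (smooth_near_act cp) => j.
have -> : act (vscale f X) (coord_fun (chart_at p) j) =
    (fun q => f q * act X (coord_fun (chart_at p) j) q).
  by apply/funext => q; exact: act_vscale.
by apply: (smooth_functionM hN) => //; apply: smooth_act => //; exact: smooth_coord_fun.
Qed.

Lemma vopp_scale X : vopp X = vscale (fun=> -1) X.
Proof. by apply/funext => q; rewrite /vopp /vscale scaleN1r. Qed.

Lemma smooth_vopp p X : smooth_near p X -> smooth_near p (vopp X).
Proof.
by move=> sX; rewrite vopp_scale; apply: smooth_vscale => //; exact: (smooth_function_cst hN).
Qed.

Lemma smooth_vsub p X Y : smooth_near p X -> smooth_near p Y -> smooth_near p (vsub X Y).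
Proof. by move=> sX sY; apply: smooth_vadd => //; exact: smooth_vopp. Qed.

(** In coordinates, X(Y f) is the sum of the second differential of f at (Y, X)
and of 'd f applied to the derivative of Y along X; the second differentials
cancel by symmetry. *)
Lemma act_bracket p X Y f : smooth_near p X -> smooth_near p Y ->
  smooth_function_near p f ->
  act (bracket X Y) f p = act X (act Y f) p - act Y (act X f) p.
Proof.
have cp := dom_chart_at hN p; set c := chart_at p in cp *.
have half V W : smooth_near p V -> smooth_near p W -> smooth_function_near p f ->
    act V (act W f) p =
    'd (fun u => 'd (f \o param c : 'rV[R]_m -> R) u (W p)) (coord c p) (V p) +
    'd (f \o param c : 'rV[R]_m -> R) (coord c p) ('d (local_rep c W) (coord c p) (V p)).
  move=> sV sW sf; have sWf := smooth_act sW sf.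
  have /(smooth_function_nearP hN _ cp)/smooth_at_diffble dWf := sWf.
  have [_ e] := near_is_diff (near_act_chart W cp sf) dWf.
  apply: etrans (esym (e (V p))) _.
  have Wp : local_rep c W (coord c p) = W p.
    by rewrite /local_rep coordK // components_chart_at.
  rewrite -[X in _ = 'd (fun u => 'd _ u X) _ _ + _]Wp.
  apply: diff_diff_apply; first exact/(smooth_function_nearP hN _ cp).
  exact/(smooth_nearP hN _ cp).
move=> sX sY sf.
rewrite (half X Y) // (half Y X) //.
have /(smooth_function_nearP hN _ cp) [A [oA Ap CA]] := sf.
have sym : 'd (fun u => 'd (f \o param c : 'rV[R]_m -> R) u (Y p)) (coord c p) (X p)
  = 'd (fun u => 'd (f \o param c : 'rV[R]_m -> R) u (X p)) (coord c p) (Y p).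
  exact: diff_diffC oA Ap (CA 2).
have combine (a b d e : R) : a = b -> d - e = a + d - (b + e) by move=> ->; ring.
exact: etrans (linearB _ _ _) (combine _ _ _ _ sym).
Qed.

End fields.

(** * The Lie algebra of vector fields *)

(* Derivatives become variables before ring or lra is called: comparing two of them
up to conversion would unfold the differentials. *)
Ltac abstract_act :=
  repeat match goal with |- context [act ?X ?f ?p] => generalize (act X f p); intro end.

Section lie_algebra.
Context {R : realType} {m : nat} (N : charted R m).
Hypothesis hN : smooth_atlas N.
Implicit Types (p q : N) (c : chart N) (f g : N -> R) (X Y Z : vfield N).

Lemma smooth_bracket p X Y : smooth_near p X -> smooth_near p Y ->
  smooth_near p (bracket X Y).
Proof.
move=> sX sY; have cp := dom_chart_at hN p; apply: (smooth_near_act hN cp) => j.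
pose x := coord_fun (chart_at p) j.
have sx : smooth_function_near p x by exact: smooth_coord_fun.
apply: (smooth_function_near_eq hN
  (f := fun q => act X (act Y x) q + -1 * act Y (act X x) q)).
  apply: filterS3 (smooth_near_near hN sX) (smooth_near_near hN sY)
    (smooth_function_near_near hN sx) => q sXq sYq sxq.
  by rewrite act_bracket // mulN1r.
apply: (smooth_functionD hN); first by do 2! apply: smooth_act => //.
apply: (smooth_functionM hN); first exact: (smooth_function_cst hN).
by do 2! apply: smooth_act => //.
Qed.

Lemma bracketC p X Y : bracket X Y p = - bracket Y X p.
Proof. by rewrite /bracket opprB. Qed.

Lemma bracket_self p X : bracket X X p = 0.
Proof. by rewrite /bracket subrr. Qed.

Lemma act_fields_eq p X X' f : (\forall q \near at_pt p, X q = X' q) ->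
  \forall q \near at_pt p, act X f q = act X' f q.
Proof. by apply: filterS => q e; rewrite /act e. Qed.

Lemma act_vec p X X' f : X p = X' p -> act X f p = act X' f p.
Proof. by rewrite /act => ->. Qed.

#[local] Opaque act bracket.

Lemma bracket_eqr p X Y Y' : smooth_near p X -> smooth_near p Y ->
  (\forall q \near at_pt p, Y q = Y' q) -> bracket X Y p = bracket X Y' p.
Proof.
move=> sX sY e; have sY' := smooth_near_eq hN e sY.
apply: (vector_eq hN) => f sf; rewrite !act_bracket //.
apply: (congr2 (fun a b : R => a - b)).
  apply: act_eq => //; last exact: smooth_act.
  exact: act_fields_eq.
by apply: act_vec; exact: (at_pt_self hN e).
Qed.

Lemma bracket_eq p X X' Y Y' : smooth_near p X -> smooth_near p Y ->
  (\forall q \near at_pt p, X q = X' q) -> (\forall q \near at_pt p, Y q = Y' q) ->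
  bracket X Y p = bracket X' Y' p.
Proof.
move=> sX sY eX eY; have sX' := smooth_near_eq hN eX sX.
rewrite (bracket_eqr sX sY eY) bracketC (bracket_eqr _ sX eX) -?bracketC //.
exact: smooth_near_eq sY.
Qed.

Lemma bracketDr p X Y Z : smooth_near p X -> smooth_near p Y -> smooth_near p Z ->
  bracket X (vadd Y Z) p = bracket X Y p + bracket X Z p.
Proof.
move=> sX sY sZ; apply: (@vector_eq _ _ _ hN _ _ (vadd (bracket X Y) (bracket X Z))) => f sf.
have sYZ := smooth_vadd hN sY sZ.
rewrite act_vadd !act_bracket // act_vadd.
have -> : act (vadd Y Z) f = (fun q => act Y f q + act Z f q).
  by apply/funext => q; exact: act_vadd.
by rewrite actD; [abstract_act; ring|exact: hN|exact: smooth_act..].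
Qed.

Lemma bracketZr p X Y f : smooth_near p X -> smooth_near p Y ->
  smooth_function_near p f ->
  bracket X (vscale f Y) p = act X f p *: Y p + f p *: bracket X Y p.
Proof.
move=> sX sY sf.
apply: (@vector_eq _ _ _ hN _ _
  (vadd (vscale (act X f) Y) (vscale f (bracket X Y)))) => g sg.
have sfY := smooth_vscale hN sf sY.
rewrite act_vadd !act_vscale !act_bracket // act_vscale.
have -> : act (vscale f Y) g = (fun q => f q * act Y g q).
  by apply/funext => q; exact: act_vscale.
by rewrite actM; [abstract_act; ring|exact: hN|exact: sf|exact: smooth_act].
Qed.

Lemma bracketDl p X Y Z : smooth_near p X -> smooth_near p Y -> smooth_near p Z ->
  bracket (vadd X Y) Z p = bracket X Z p + bracket Y Z p.
Proof. by move=> *; rewrite bracketC bracketDr // opprD -(bracketC p X) -(bracketC p Y). Qed.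

Lemma bracketZl p X Y f : smooth_near p X -> smooth_near p Y ->
  smooth_function_near p f ->
  bracket (vscale f X) Y p = - act Y f p *: X p + f p *: bracket X Y p.
Proof.
move=> sX sY sf; rewrite bracketC bracketZr // opprD scaleNr; congr (_ + _).
by rewrite -scalerN -(bracketC p X Y).
Qed.

Lemma bracketNl p X Y : smooth_near p X -> smooth_near p Y ->
  bracket (vopp X) Y p = - bracket X Y p.
Proof.
move=> sX sY; rewrite vopp_scale bracketZl //; last exact: (smooth_function_cst hN).
by rewrite act_cst oppr0 scale0r add0r scaleN1r.
Qed.

Lemma bracket0r p X Y : smooth_near p X -> smooth_near p Y ->
  (\forall q \near at_pt p, Y q = 0) -> bracket X Y p = 0.
Proof.
move=> sX sY Y0; have s0 := smooth_function_cst hN p 0.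
rewrite (@bracket_eqr p X Y (vscale (fun=> 0) Y)) //; last first.
  by apply: filterS Y0 => q; rewrite /vscale scale0r.
by rewrite bracketZr // act_cst !scale0r addr0.
Qed.

(** On a function, both sides are the same combination of iterated derivatives. *)
Lemma jacobi p X Y Z : smooth_near p X -> smooth_near p Y -> smooth_near p Z ->
  bracket X (bracket Y Z) p = bracket (bracket X Y) Z p + bracket Y (bracket X Z) p.
Proof.
move=> sX sY sZ.
pose rhs := vadd (bracket (bracket X Y) Z) (bracket Y (bracket X Z)).
apply: (@vector_eq _ _ _ hN _ _ rhs) => f sf.
have sXY := smooth_bracket sX sY; have sXZ := smooth_bracket sX sZ.
have sYZ := smooth_bracket sY sZ.
have outer U V W : smooth_near p U -> smooth_near p V -> smooth_near p W ->
    act U (act (bracket V W) f) p = act U (act V (act W f)) p - act U (act W (act V f)) p.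
  move=> sU sV sW.
  rewrite -(@act_eq _ _ _ hN p (fun q => act V (act W f) q + -1 * act W (act V f) q)).
  - rewrite actD ?actZ ?mulN1r //.
    + by do 2! apply: smooth_act => //.
    + by do 2! apply: smooth_act => //.
    + apply: (smooth_functionM hN); first exact: (smooth_function_cst hN).
      by do 2! apply: smooth_act => //.
  - apply: filterS3 (smooth_near_near hN sV) (smooth_near_near hN sW)
      (smooth_function_near_near hN sf) => q sVq sWq sfq.
    by rewrite act_bracket // mulN1r.
  - apply: (smooth_functionD hN); first by do 2! apply: smooth_act => //.
    apply: (smooth_functionM hN); first exact: (smooth_function_cst hN).
    by do 2! apply: smooth_act => //.
have inner U V W : smooth_near p U -> smooth_near p V -> smooth_near p W ->
    act (bracket U V) (act W f) p = act U (act V (act W f)) p - act V (act U (act W f)) p.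
  by move=> sU sV sW; rewrite act_bracket //; exact: smooth_act.
rewrite /rhs act_vadd.
move: (act_bracket hN sX sYZ sf) (act_bracket hN sXY sZ sf) (act_bracket hN sY sXZ sf).
move: (outer X Y Z sX sY sZ) (inner Y Z X sY sZ sX).
move: (inner X Y Z sX sY sZ) (outer Z X Y sZ sX sY).
move: (outer Y X Z sY sX sZ) (inner X Z Y sX sZ sY).
abstract_act; lra.
Qed.

Lemma vector_eq_chart c p (xi eta : 'rV[R]_m) : dom c p ->
  components c p xi = components c p eta -> xi = eta.
Proof.
by move=> cp e; rewrite -(chart_field_components hN xi cp) e chart_field_components.
Qed.

Lemma smooth_chart_field c p xi : dom c p -> smooth_near p (chart_field c xi).
Proof.
move=> cp; apply/(smooth_nearP hN _ cp); apply: (@smooth_at_eq _ _ _ _ (cst xi)).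
  apply: filterS (near_transition hN cp cp) => u [cu _ uK].
  by rewrite /local_rep components_chart_field.
exact: smooth_at_cst.
Qed.

Lemma components_bracket_chart_field c p X xi : dom c p -> smooth_near p X ->
  components c p (bracket X (chart_field c xi) p) =
  - 'd (local_rep c X) (coord c p) xi.
Proof.
move=> cp sX; have sxi := smooth_chart_field xi cp.
apply/rowP => j; have sx := smooth_coord_fun hN j cp.
rewrite -(act_coord_fun hN _ j cp) act_bracket // mxE.
have -> : act X (act (chart_field c xi) (coord_fun c j)) p = 0.
  rewrite -(act_cst p X (xi 0 j)); apply: act_eq => //; last exact: smooth_act.
  apply: filterS (at_pt_dom hN cp) => q cq.
  by rewrite act_coord_fun // components_chart_field.
rewrite sub0r; congr (- _).
rewrite (act_chart hN _ cp); last exact: smooth_act.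
rewrite components_chart_field //.
have dX : differentiable (local_rep c X) (coord c p).
  exact/smooth_at_diffble/(smooth_nearP hN _ cp).
apply: etrans (diff_coord j xi dX).
have E : \forall u \near coord c p,
   local_rep c X u 0 j = (act X (coord_fun c j) \o param c) u.
  apply: filterS (near_transition hN cp cp) => u [cu _ uK].
  by rewrite /= act_coord_fun.
have sXj := smooth_at_coord j ((smooth_nearP hN _ cp).1 sX).
have [_ e] := near_is_diff E (smooth_at_diffble sXj).
exact: e.
Qed.

Lemma bracket_chart_fields c p xi eta : dom c p ->
  bracket (chart_field c xi) (chart_field c eta) p = 0.
Proof.
move=> cp; apply: (vector_eq_chart cp).
apply: etrans (components_bracket_chart_field eta cp (smooth_chart_field xi cp)) _.
have E : \forall u \near coord c p, cst xi u = local_rep c (chart_field c xi) u.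
  apply: filterS (near_transition hN cp cp) => u [cu _ uK].
  by rewrite /local_rep components_chart_field.
have [_ e] := near_is_diff E (differentiable_cst _ _).
apply: etrans (congr1 -%R (etrans (e eta) (diff_cstE _ _ _))) _.
by rewrite oppr0 /components linear0.
Qed.

(** The bracket with a coordinate field differentiates components in a fixed
direction, which commutes with a constant matrix. *)
Lemma bracket_chart_field_mul c p X X' xi (A : 'M[R]_m) : dom c p ->
  smooth_near p X -> smooth_near p X' ->
  (\forall q \near at_pt p, components c q (X' q) = components c q (X q) *m A) ->
  components c p (bracket X' (chart_field c xi) p) =
  components c p (bracket X (chart_field c xi) p) *m A.
Proof.
move=> cp sX sX' XX'.
apply: etrans (components_bracket_chart_field xi cp sX') _.
apply: etrans _ (esym (congr1 (mulmx^~ A) (components_bracket_chart_field xi cp sX))).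
apply: etrans _ (esym (mulNmx _ _)); apply: (congr1 -%R).
have dX : differentiable (local_rep c X) (coord c p).
  exact/smooth_at_diffble/(smooth_nearP hN _ cp).
pose L : {linear 'rV[R]_m -> 'rV[R]_m} := mulmxr A.
have cL : continuous L by exact: linear_row_continuous.
have E : \forall u \near coord c p, (L \o local_rep c X) u = local_rep c X' u.
  have /(at_pt_chart hN _ cp) := XX'.
  by apply: filterS => u /= e; rewrite /local_rep e.
have dLX : differentiable (L \o local_rep c X) (coord c p).
  by apply: differentiable_comp => //; exact: linear_differentiable.
have [_ e] := near_is_diff E dLX.
have dL : differentiable L (local_rep c X (coord c p)) by exact: linear_differentiable.
apply: etrans (e xi) _; apply: etrans (diff_compE xi dX dL) _.
exact: diff_linE _ _ cL.
Qed.

Section tensoriality.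
Variables (V : lmodType R) (p : N) (Phi : vfield N -> V).
Hypothesis Phi_eq : forall X X', smooth_near p X ->
  (\forall q \near at_pt p, X q = X' q) -> Phi X = Phi X'.
Hypothesis PhiD : forall X Y, smooth_near p X -> smooth_near p Y ->
  Phi (vadd X Y) = Phi X + Phi Y.
Hypothesis PhiZ : forall f X, smooth_function_near p f -> smooth_near p X ->
  Phi (vscale f X) = f p *: Phi X.

(** Near p, the field X is the combination of coordinate fields whose
coefficients are its components in c. *)
Lemma tensorial_expand c X : dom c p -> smooth_near p X ->
  Phi X = \sum_j components c p (X p) 0 j *: Phi (chart_field c (delta_mx 0 j)).
Proof.
move=> cp sX.
pose F j : vfield N :=
  vscale (fun q => components c q (X q) 0 j) (chart_field c (delta_mx 0 j)).
have sc j : smooth_function_near p (fun q => components c q (X q) 0 j).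
  exact: smooth_components.
have sF j : smooth_near p (F j).
  by apply: smooth_vscale => //; exact: smooth_chart_field.
have s0 := smooth_function_cst hN p 0.
suff sums : forall s : seq 'I_m,
    smooth_near p (fun q => \sum_(j <- s) F j q : 'rV[R]_m) /\
    Phi (fun q => \sum_(j <- s) F j q) = \sum_(j <- s) Phi (F j).
  have [_ e] := sums (index_enum _).
  rewrite (@Phi_eq X (fun q => \sum_j F j q)) //.
    rewrite e; apply: eq_bigr => j _.
    by rewrite PhiZ //; exact: smooth_chart_field.
  apply: filterS (at_pt_dom hN cp) => q cq.
  rewrite -[LHS](chart_field_components hN _ cq).
  by rewrite /chart_field linear_row_expand.
elim=> [|j s [sS IH]].
  have e0 : (fun q => \sum_(j <- [::]) F j q) = vscale (fun=> 0) X.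
    by apply/funext => q; rewrite big_nil /vscale scale0r.
  by rewrite e0 big_nil PhiZ // scale0r; split=> //; exact: smooth_vscale.
have eS : (fun q => \sum_(i <- j :: s) F i q) = vadd (F j) (fun q => \sum_(i <- s) F i q).
  by apply/funext => q; rewrite big_cons.
by rewrite eS big_cons PhiD // IH; split=> //; exact: smooth_vadd.
Qed.

Lemma tensorial_eq X X' : smooth_near p X -> smooth_near p X' -> X p = X' p ->
  Phi X = Phi X'.
Proof.
have cp := dom_chart_at hN p.
by move=> sX sX' e; rewrite (tensorial_expand cp sX) (tensorial_expand cp sX') e.
Qed.

Lemma tensorial0 c X : dom c p -> smooth_near p X ->
  (forall xi, Phi (chart_field c xi) = 0) -> Phi X = 0.
Proof.
move=> cp sX H; rewrite (tensorial_expand cp sX) big1 // => j _.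
by rewrite H scaler0.
Qed.

End tensoriality.

End lie_algebra.

(** * The atlas of the tangent bundle *)

Section tangent_atlas.
Context {R : realType} {n : nat} (M : charted R n).
Hypothesis hM : smooth_atlas M.
Local Notation TM := (tangent_bundle M).
Implicit Types (c : chart M) (z : TM) (w : 'rV[R]_(n + n)).

Lemma tangent_coordE c z :
  coord (c : chart TM) z = row_mx (coord c z.1) (components c z.1 z.2).
Proof. by []. Qed.

Lemma tangent_coordK c z : dom c z.1 -> param (c : chart TM) (coord (c : chart TM) z) = z.
Proof.
case: z => x v /= cx; rewrite row_mxKl row_mxKr (coordK hM cx).
by congr pair; exact: (chart_field_components hM v cx).
Qed.

Lemma tangent_param_coord c w x : dom c x -> lsubmx w = coord c x ->
  param (c : chart TM) w = (x, chart_field c (rsubmx w) x).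
Proof. by move=> cx e /=; rewrite e (coordK hM cx). Qed.

Lemma tangent_paramK c w x : dom c x -> lsubmx w = coord c x ->
  coord (c : chart TM) (param (c : chart TM) w) = w.
Proof.
move=> cx e; rewrite (tangent_param_coord cx e) tangent_coordE /=.
by rewrite components_chart_field // -e hsubmxK.
Qed.

(** The transition maps of the tangent bundle are (x, y) |-> (phi x, 'd phi x
y), where phi is a transition map of the base. *)
Lemma tangent_transition c c' w x : dom c x -> dom c' x -> lsubmx w = coord c x ->
  (coord (c' : chart TM) \o param (c : chart TM)) w =
  row_mx ((coord c' \o param c) (lsubmx w))
         ('d (coord c' \o param c) (lsubmx w) (rsubmx w)).
Proof.
move=> cx c'x e; rewrite [LHS]/comp (tangent_param_coord cx e) tangent_coordE.
rewrite e [(coord c' \o param c) _]/= coordK //; congr (row_mx _ _) => /=.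
apply: etrans (components_change hM _ cx c'x) _.
by rewrite components_chart_field.
Qed.

Lemma tangent_chart_image c c' :
  coord (c : chart TM) @` (dom (c : chart TM) `&` dom (c' : chart TM)) =
  lsubmx @^-1` (coord c @` (dom c `&` dom c')).
Proof.
apply/seteqP; split=> [_ [z [cz c'z] <-]|w [x [cx c'x] /esym e]] /=.
  by exists z.1 => //; rewrite row_mxKl.
exists (param (c : chart TM) w); last exact: tangent_paramK cx e.
by rewrite (tangent_param_coord cx e).
Qed.

Lemma smooth_lsubmx w : smooth_at w (lsubmx : 'rV[R]_(n + n) -> 'rV[R]_n).
Proof.
exact: (@smooth_at_linear _ _ _ _ _ (@lsubmx R 1 n n) id
  (@continuous_lsubmx R 1 n n) (smooth_at_id w)).
Qed.

Lemma smooth_rsubmx w : smooth_at w (rsubmx : 'rV[R]_(n + n) -> 'rV[R]_n).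
Proof.
exact: (@smooth_at_linear _ _ _ _ _ (@rsubmx R 1 n n) id
  (@continuous_rsubmx R 1 n n) (smooth_at_id w)).
Qed.

Lemma smooth_at_mulmx k m p (A : 'M[R]_(m, p)) (f : 'rV[R]_k -> 'rV[R]_m) x :
  smooth_at x f -> smooth_at x (fun u => f u *m A).
Proof.
pose L : {linear 'rV[R]_m -> 'rV[R]_p} := mulmxr A.
by apply: (@smooth_at_linear _ _ _ _ _ L); exact: linear_row_continuous.
Qed.

Lemma smooth_row_mx k (f g : 'rV[R]_k -> 'rV[R]_n) x :
  smooth_at x f -> smooth_at x g -> smooth_at x (fun u => row_mx (f u) (g u)).
Proof.
move=> sf sg.
have -> : (fun u => row_mx (f u) (g u)) =
    (fun u => f u *m row_mx 1%:M 0) + (fun u => g u *m row_mx 0 1%:M).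
  apply/funext => u; rewrite fctE !mul_mx_row !mulmx1 !mulmx0.
  by rewrite add_row_mx addr0 add0r.
by apply: smooth_atD; exact: smooth_at_mulmx.
Qed.

Lemma smooth_tangent_transition c c' :
  open (coord (c : chart TM) @` (dom (c : chart TM) `&` dom (c' : chart TM))) /\
  class_Coo (coord (c : chart TM) @` (dom (c : chart TM) `&` dom (c' : chart TM)))
    (coord (c' : chart TM) \o param (c : chart TM)).
Proof.
have [_ _ /(_ c c') [oA _]] := hM.
have oT : open (coord (c : chart TM) @` (dom (c : chart TM) `&` dom (c' : chart TM))).
  rewrite tangent_chart_image; apply: open_comp => // w _.
  exact: continuous_lsubmx.
split=> //; apply: smooth_at_class_C => w Tw.
have nT := open_nbhs_nbhs (conj oT Tw).
apply: (@smooth_at_eq R _ 'rV[R]_(n + n) w (fun w => row_mx ((coord c' \o param c) (lsubmx w))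
         ('d (coord c' \o param c) (lsubmx w) (rsubmx w)))).
  apply: filterS nT => u; rewrite tangent_chart_image => -[x [cx c'x] e].
  by rewrite [RHS](tangent_transition cx c'x).
move: Tw; rewrite tangent_chart_image => -[x [cx c'x] e].
have st := smooth_transition hM cx c'x.
have sl := smooth_lsubmx w; have sr := smooth_rsubmx w.
apply: smooth_row_mx.
  by apply: (@smooth_at_compv _ _ _ _ _ lsubmx) => //; rewrite -e.
by apply: smooth_at_diff_applyv => //; rewrite -e.
Qed.

Lemma tangent_atlas : smooth_atlas TM.
Proof.
split=> [z|c z|c c']; first exact: (dom_chart_at hM z.1).
  exact: tangent_coordK.
exact: smooth_tangent_transition.
Qed.

(** The first component phi x of a transition map of the tangent bundle does not
depend on y. *)
Lemma diff_tangent_transition c c' (z : TM) (v : 'rV[R]_(n + n)) :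
  dom c z.1 -> dom c' z.1 ->
  lsubmx ('d (coord (c' : chart TM) \o param (c : chart TM)) (coord (c : chart TM) z) v) =
  'd (coord c' \o param c) (coord c z.1) (lsubmx v).
Proof.
move=> cz c'z; set T := coord (c' : chart TM) \o param (c : chart TM).
set w := coord (c : chart TM) z.
have dT : differentiable T w.
  exact/smooth_at_diffble/(smooth_transition tangent_atlas).
have lw : lsubmx w = coord c z.1 by rewrite /w tangent_coordE row_mxKl.
have dphi : differentiable (coord c' \o param c) (lsubmx w).
  by rewrite lw; exact/smooth_at_diffble/(smooth_transition hM).
have dl y : differentiable (lsubmx : 'rV[R]_(n + n) -> 'rV[R]_n) y.
  exact: differentiable_lsubmx.
have cl : continuous (lsubmx : 'rV[R]_(n + n) -> 'rV[R]_n) by exact: continuous_lsubmx.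
have E : \forall u \near w, ((coord c' \o param c) \o lsubmx) u = (lsubmx \o T) u.
  have [oT _] := smooth_tangent_transition c c'.
  apply: filterS (open_nbhs_nbhs (conj oT _)); last by exists z.
  move=> u; rewrite tangent_chart_image => -[x [cx c'x] e].
  apply: esym; apply: etrans (congr1 lsubmx (tangent_transition cx c'x (esym e))) _.
  exact: row_mxKl.
have [_ e] := near_is_diff E (differentiable_comp (dl w) dphi).
apply: etrans (esym (diff_linE _ _ cl)) _.
apply: etrans (esym (diff_compE v dT (dl _))) _.
apply: etrans (e v) _; apply: etrans (diff_compE v (dl w) dphi) _.
by rewrite lw; congr ('d _ _ _); exact: diff_linE.
Qed.

(** For fixed x, the second component 'd phi x y is linear in y. *)
Lemma diff_tangent_transition_vertical c c' (z : TM) (b : 'rV[R]_n) :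
  dom c z.1 -> dom c' z.1 ->
  'd (coord (c' : chart TM) \o param (c : chart TM)) (coord (c : chart TM) z)
    (row_mx 0 b) =
  row_mx 0 ('d (coord c' \o param c) (coord c z.1) b).
Proof.
move=> cz c'z; set T := coord (c' : chart TM) \o param (c : chart TM).
set w := coord (c : chart TM) z.
set phi := coord c' \o param c.
have dT : differentiable T w.
  exact/smooth_at_diffble/(smooth_transition tangent_atlas).
pose x0 : 'rV[R]_n := coord c z.1; pose y0 : 'rV[R]_n := components c z.1 z.2.
have wE : w = row_mx x0 y0 by [].
have cr : continuous (rsubmx : 'rV[R]_(n + n) -> 'rV[R]_n) by exact: continuous_rsubmx.
have dr y : differentiable (rsubmx : 'rV[R]_(n + n) -> 'rV[R]_n) y.
  exact: differentiable_rsubmx.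
pose i : {linear 'rV[R]_n -> 'rV[R]_(n + n)} := mulmxr (row_mx 0 1%:M).
have iE y : i y = row_mx 0 y by rewrite /= mul_mx_row mulmx0 mulmx1.
have ci : continuous i by exact: linear_row_continuous.
pose l : 'rV[R]_n -> 'rV[R]_(n + n) := cst (row_mx x0 0) + i.
have lE y : l y = row_mx x0 y.
  by rewrite [LHS]/= /l fctE [X in _ + X]iE add_row_mx addr0 add0r.
have di : differentiable i y0 by exact: linear_differentiable.
have dl : differentiable l y0 by apply: differentiableD di; exact: differentiable_cst.
have dlE : 'd l y0 b = row_mx 0 b.
  apply: etrans (diffDE b (differentiable_cst _ _) di) _.
  apply: etrans (congr2 +%R (diff_cstE _ _ _) (diff_linE _ _ ci)) _.
  by rewrite add0r iE.
have dTl : differentiable T (l y0) by rewrite lE -wE.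
have L : forall y, (rsubmx \o (T \o l)) y = 'd phi x0 y.
  move=> y; apply: etrans (congr1 (rsubmx \o T) (lE y)) _.
  have lx : lsubmx (row_mx x0 y) = coord c z.1 by rewrite row_mxKl.
  apply: etrans (congr1 rsubmx (tangent_transition cz c'z lx)) _.
  by rewrite row_mxKr lx row_mxKr.
have cphi : continuous ('d phi x0) by exact: linear_row_continuous.
have step : rsubmx ('d T w (row_mx 0 b)) = 'd phi x0 b.
  have E : \forall y \near y0, (rsubmx \o (T \o l)) y = 'd phi x0 y.
    exact: (filterS (fun y _ => L y) (@filterT _ (nbhs y0) _)).
  have dTl' : differentiable (T \o l) y0 by exact: differentiable_comp.
  have [_ e] := near_is_diff E (differentiable_comp dTl' (dr _)).
  apply: etrans (diff_linE y0 b cphi); apply: etrans (esym (e b)).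
  apply: esym; apply: etrans (diff_compE b dTl' (dr _)) _.
  apply: etrans (diff_linE _ _ cr) _; congr rsubmx.
  apply: etrans (diff_compE b dl dTl) _.
  by rewrite lE -wE; congr ('d T w _); exact: dlE.
rewrite -[LHS]hsubmxK step; congr row_mx.
by rewrite diff_tangent_transition // row_mxKl linear0.
Qed.

End tangent_atlas.

(** * The almost tangent structure and the Liouville field *)

#[local] Opaque act bracket.

Section tangent_fields.
Context {R : realType} {n : nat} (M : charted R n).
Hypothesis hM : smooth_atlas M.
Local Notation TM := (tangent_bundle M).
Local Notation VF := (vfield TM).
Implicit Types (c : chart TM) (z : TM) (X Y Z W : VF) (xi : 'rV[R]_(n + n)).
Let hTM : smooth_atlas TM := tangent_atlas hM.

Lemma mul_Jmx xi : xi *m Jmx = row_mx 0 (lsubmx xi).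
Proof.
rewrite -[in LHS](hsubmxK xi) /Jmx mul_row_block.
by rewrite !mulmx0 mulmx1 !addr0.
Qed.

Lemma mul_Jmx_eq0 xi : xi *m Jmx = 0 -> lsubmx xi = 0.
Proof. by rewrite mul_Jmx => /(congr1 rsubmx); rewrite row_mxKr linear0. Qed.

Lemma Jmx_sq : Jmx *m Jmx = 0 :> 'M[R]_(n + n).
Proof. by rewrite /Jmx mulmx_block !mulmx0 !mul0mx !addr0 block_mx0. Qed.

Lemma mul_JmxJmx xi : xi *m Jmx *m Jmx = 0.
Proof. by rewrite -mulmxA Jmx_sq mulmx0. Qed.

(** The differential of a transition map is block triangular with equal diagonal
blocks, so that J has the matrix [Jmx] in all induced charts. *)
Lemma components_J c z xi : dom c z ->
  components c z (xi *m Jmx) = components c z xi *m Jmx.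
Proof.
move=> cz; have z0 := dom_chart_at hM z.1.
rewrite !mul_Jmx /components.
apply: etrans (diff_tangent_transition_vertical hM (lsubmx xi) z0 cz) _.
by congr (row_mx 0 _); rewrite -(diff_tangent_transition hM xi z0 cz).
Qed.

Lemma near_components_J c z X : dom c z ->
  \forall q \near at_pt z, components c q (J X q) = components c q (X q) *m Jmx.
Proof.
by move=> cz; apply: filterS (at_pt_dom hTM cz) => q cq; exact: components_J.
Qed.

Definition chart_mul c (A : 'M[R]_(n + n)) X : VF :=
  fun q => chart_field c (components c q (X q) *m A) q.

Lemma smooth_chart_mul c z A X : dom c z -> smooth_near z X ->
  smooth_near z (chart_mul c A X).
Proof.
move=> cz /(smooth_nearP hTM _ cz) sX; apply/(smooth_nearP hTM _ cz).
apply: (@smooth_at_eq _ _ _ _ (fun u => local_rep c X u *m A)).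
  apply: filterS (near_transition hTM cz cz) => u [cu _ uK].
  by rewrite [RHS]/local_rep /chart_mul components_chart_field.
exact: smooth_at_mulmx.
Qed.

Lemma smooth_J z X : smooth_near z X -> smooth_near z (J X).
Proof.
have cz := dom_chart_at hTM z; move=> sX.
apply: (smooth_near_eq hTM _ (smooth_chart_mul Jmx cz sX)).
apply: filterS (at_pt_dom hTM cz) => q cq.
by rewrite /chart_mul -components_J // chart_field_components.
Qed.

Lemma J_chart_field c z xi : dom c z ->
  J (chart_field c xi) z = chart_field c (xi *m Jmx) z.
Proof.
move=> cz; apply: (vector_eq_chart hTM cz).
by rewrite components_J // !components_chart_field.
Qed.

Lemma near_J_chart_field c z xi : dom c z ->
  \forall q \near at_pt z, J (chart_field c xi) q = chart_field c (xi *m Jmx) q.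
Proof.
by move=> cz; apply: filterS (at_pt_dom hTM cz) => q cq; exact: J_chart_field.
Qed.

Lemma JJ X z : J (J X) z = 0.
Proof. exact: mul_JmxJmx. Qed.

Lemma J_vertical_chart_field c z a :
  dom c z -> J (chart_field c (row_mx 0 a)) z = 0.
Proof.
by move=> cz; rewrite J_chart_field // mul_Jmx row_mxKl row_mx0 /chart_field linear0.
Qed.

(** The matrix of J is constant in an induced chart. *)
Lemma bracket_J c z X xi : dom c z -> smooth_near z X ->
  bracket (J X) (chart_field c xi) z = J (bracket X (chart_field c xi)) z.
Proof.
move=> cz sX; apply: (vector_eq_chart hTM cz).
rewrite components_J //; apply: (bracket_chart_field_mul hTM) => //.
  exact: smooth_J.
exact: near_components_J.
Qed.

(** In every induced chart, C = y^i d/dy^i: the matrix keeps the y-half of the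
coordinates. *)
Lemma components_liouville c z : dom c z ->
  components c z (liouville z) = coord c z *m block_mx 0 0 0 1%:M.
Proof.
move=> cz; have z0 := dom_chart_at hM z.1.
apply: etrans (diff_tangent_transition_vertical hM z.2 z0 cz) _.
by rewrite (@tangent_coordE R n M c z) mul_row_block !mulmx0 mulmx1 !add0r.
Qed.

Lemma smooth_liouville z : smooth_near z (@liouville R n M).
Proof.
have cz := dom_chart_at hTM z; apply/(smooth_nearP hTM _ cz).
apply: (@smooth_at_eq _ _ _ _ (fun u => u *m block_mx 0 0 0 1%:M)).
  apply: filterS (near_transition hTM cz cz) => u [cu _ uK].
  by rewrite [RHS]/local_rep components_liouville // uK.
by apply: smooth_at_mulmx; exact: smooth_at_id.
Qed.

Lemma J_liouville z : J (@liouville R n M) z = 0.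
Proof. by rewrite /J /liouville mul_Jmx row_mxKl row_mx0. Qed.

Lemma bracket_liouville c z xi : dom c z ->
  bracket (@liouville R n M) (chart_field c xi) z =
  - chart_field c (row_mx 0 (rsubmx xi)) z.
Proof.
move=> cz; apply: (vector_eq_chart hTM cz).
apply: etrans (components_bracket_chart_field hTM xi cz (smooth_liouville z)) _.
pose L : {linear 'rV[R]_(n + n) -> 'rV[R]_(n + n)} := mulmxr (block_mx 0 0 0 1%:M).
have cL : continuous L by exact: linear_row_continuous.
have E : \forall u \near coord c z, L u = local_rep c (@liouville R n M) u.
  apply: filterS (near_transition hTM cz cz) => u [cu _ uK].
  by rewrite [RHS]/local_rep components_liouville // uK.
have dL : differentiable L (coord c z) by exact: linear_differentiable.
have [_ e] := near_is_diff E dL.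
apply: etrans (congr1 -%R (etrans (e xi) (diff_linE _ _ cL))) _.
have -> : L xi = row_mx 0 (rsubmx xi).
  by rewrite /= -[in LHS](hsubmxK xi) mul_row_block !mulmx0 mulmx1 !add0r.
apply: etrans (congr1 -%R (esym (components_chart_field hTM _ cz))) _.
exact: esym (linearN _ _).
Qed.

(** By [bracket_J], this is the bracket of JW = 0 with the coordinate field. *)
Lemma bracket_vertical_chart_field c z W xi : dom c z -> smooth_near z W ->
  (\forall q \near at_pt z, J W q = 0) -> J (bracket W (chart_field c xi)) z = 0.
Proof.
move=> cz sW JW; rewrite -bracket_J //.
have sxi := smooth_chart_field hTM xi cz.
by rewrite bracketC (bracket0r hTM) ?oppr0 //; exact: smooth_J.
Qed.

(** If X = b^i d/dy^i in an induced chart, then W = b^i d/dx^i; this field is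
the product of the components of X with the transpose of [Jmx]. *)
Lemma vertical_lift z X : smooth_near z X -> (\forall q \near at_pt z, J X q = 0) ->
  exists2 W, smooth_near z W & \forall q \near at_pt z, X q = J W q.
Proof.
have cz := dom_chart_at hTM z; move=> sX JX.
exists (chart_mul (chart_at z) Jmx^T X); first exact: smooth_chart_mul.
apply: filterS2 (at_pt_dom hTM cz) JX => q cq JX.
apply: (vector_eq_chart hTM cq); rewrite components_J // components_chart_field //.
have : components (chart_at z) q (X q) *m Jmx = 0.
  by rewrite -components_J // [X q *m _]JX /components linear0.
move/mul_Jmx_eq0 => l0.
have JtJ : (@Jmx R n)^T *m Jmx = block_mx 0 0 0 1%:M.
  by rewrite /Jmx tr_block_mx mulmx_block !trmx0 trmx1 !mulmx0 !mul0mx !mulmx1 !addr0.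
rewrite -mulmxA JtJ -(hsubmxK (components _ _ _)) l0.
by rewrite mul_row_block !mulmx0 mulmx1 !add0r.
Qed.

(** The vector part of a point vanishes if and only if its components in a fixed
chart do, and these are continuous. *)
Lemma slit_near z : slit z -> \forall q \near at_pt z, slit q.
Proof.
move=> z2; have cz := dom_chart_at hTM z; apply/(at_pt_chart hTM _ cz).
have z0 : rsubmx (coord (chart_at z) z) != 0.
  have -> : rsubmx (coord (chart_at z) z) = z.2.
    rewrite (@tangent_coordE R n M) row_mxKr; exact: components_chart_at.
  exact: z2.
have [j zj] : exists j, rsubmx (coord (chart_at z) z) 0 j != 0.
  apply/existsP; rewrite -negb_forall; apply: contra z0 => /forallP H.
  by apply/eqP/rowP => j; rewrite [RHS]mxE; apply/eqP; exact: H.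
have cont : {for coord (chart_at z) z,
    continuous (fun u : 'rV[R]_(n + n) => (rsubmx u : 'rV[R]_n) 0 j)}.
  exact/differentiable_continuous/smooth_at_diffble/smooth_at_coord/smooth_rsubmx.
have nj : \forall u \near coord (chart_at z) z,
    (rsubmx (u : 'rV[R]_(n + n)) : 'rV[R]_n) 0 j != 0.
  exact: (cvgr_neq0 _ cont zj).
apply: filterS2 nj (near_transition hTM cz cz) => u uj [cu _ uK].
set q := param (chart_at z) u in cu uK *.
apply/eqP => q2; move: uK uj; rewrite (@tangent_coordE R n M) q2 /components linear0.
by move=> <-; rewrite row_mxKr mxE eqxx.
Qed.

Lemma open_slit : open_in (@slit R n M).
Proof. by apply/(open_in_at_pt hTM) => z; exact: slit_near. Qed.

End tangent_fields.

(** * The canonical spray *)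

Section coordinate_fields.
Context {R : realType} {n : nat} (M : charted R n).
Hypothesis hM : smooth_atlas M.
Local Notation TM := (tangent_bundle M).
Local Notation VF := (vfield TM).
Implicit Types (c : chart TM) (z : TM) (X Y Z W : VF) (a : 'rV[R]_n).
Let hTM : smooth_atlas TM := tangent_atlas hM.
Local Notation C := (@liouville R n M).

(** The coordinate fields a^i d/dx^i and a^i d/dy^i of an induced chart. *)
Definition dx c a : VF := chart_field c (row_mx a 0).
Definition dy c a : VF := chart_field c (row_mx 0 a).

Lemma smooth_dx c z a : dom c z -> smooth_near z (dx c a).
Proof. exact: smooth_chart_field. Qed.

Lemma smooth_dy c z a : dom c z -> smooth_near z (dy c a).
Proof. exact: smooth_chart_field. Qed.

Lemma near_J_dx c z a : dom c z -> \forall q \near at_pt z, J (dx c a) q = dy c a q.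
Proof.
move=> cz; apply: filterS (near_J_chart_field hM (row_mx a 0) cz) => q ->.
by rewrite mul_Jmx row_mxKl.
Qed.

Lemma near_J_dy c z a : dom c z -> \forall q \near at_pt z, J (dy c a) q = 0.
Proof.
move=> cz; apply: filterS (at_pt_dom hTM cz) => q cq.
exact: J_vertical_chart_field.
Qed.

Lemma bracket_liouville_dx c z a : dom c z -> bracket C (dx c a) z = 0.
Proof.
move=> cz; rewrite /dx bracket_liouville // row_mxKr row_mx0.
by rewrite /chart_field linear0 oppr0.
Qed.

Lemma bracket_liouville_dy c z a : dom c z -> bracket C (dy c a) z = - dy c a z.
Proof. by move=> cz; rewrite /dy bracket_liouville // row_mxKr. Qed.

Lemma J_vadd X Y : J (vadd X Y) = vadd (J X) (J Y).
Proof. by apply/funext => z; rewrite /J /vadd mulmxDl. Qed.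

Lemma J_vopp X : J (vopp X) = vopp (J X).
Proof. by apply/funext => z; rewrite /J /vopp mulNmx. Qed.

Lemma J_vscale f X : J (vscale f X) = vscale f (J X).
Proof. by apply/funext => z; rewrite /J /vscale -scalemxAl. Qed.

Lemma act_vsub X Y (f : TM -> R) z : act (vsub X Y) f z = act X f z - act Y f z.
Proof. by rewrite act_vadd act_vopp. Qed.

End coordinate_fields.

Section spray.
Context {R : realType} {n : nat} (M : charted R n).
Hypothesis hM : smooth_atlas M.
Local Notation TM := (tangent_bundle M).
Local Notation VF := (vfield TM).
Implicit Types (c : chart TM) (z : TM) (X Y Z W : VF) (a : 'rV[R]_n).
Let hTM : smooth_atlas TM := tangent_atlas hM.
Local Notation C := (@liouville R n M).
Variables (E : TM -> R) (hE : finsler_space E).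
Variables (S : VF) (hS : canonical_spray E S).

Lemma smooth_energy z : slit z -> smooth_function_near z E.
Proof. by move=> sz; exists (@slit R n M); split=> //; [exact: open_slit|case: hE]. Qed.

Lemma smooth_spray z : slit z -> smooth_near z S.
Proof. by move=> sz; exists (@slit R n M); split=> //; [exact: open_slit|case: hS]. Qed.

Lemma smooth_act_energy z X : slit z -> smooth_near z X ->
  smooth_function_near z (act X E).
Proof. by move=> sz sX; apply: smooth_act => //; exact: smooth_energy. Qed.

Lemma OmegaE X Y z : Omega E X Y z =
  act X (act (J Y) E) z - act Y (act (J X) E) z - act (J (bracket X Y)) E z.
Proof. by []. Qed.

(** The form d_J E vanishes on vertical fields. *)
Lemma Omega_vertical z W Y : slit z -> smooth_near z W -> smooth_near z Y ->
  (\forall q \near at_pt z, J W q = 0) ->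
  Omega E W Y z = act W (act (J Y) E) z - act (J (bracket W Y)) E z.
Proof.
move=> sz sW sY JW; rewrite OmegaE.
have -> : act Y (act (J W) E) z = 0.
  rewrite -(act_cst z Y 0); apply: (act_eq hTM).
    by apply: filterS JW => q; exact: act0.
  by apply: smooth_act_energy => //; exact: smooth_J.
by rewrite subr0.
Qed.

(** By [Omega_vertical], Omega(W, Y) = W(JY E) - J[W, Y] E. It is tensorial in
Y, and the second term vanishes when Y is a coordinate field. The form of the
hypothesis covers the nondegeneracy of Omega on vertical vectors (k = 0) and the
field W = C (k = 1). *)
Lemma Omega_vertical_eigen c z (k : R) W Y : slit z -> dom c z ->
  smooth_near z W -> smooth_near z Y ->
  (\forall q \near at_pt z, J W q = 0) ->
  (forall a, act W (act (dy c a) E) z = k * act (dy c a) E z) ->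
  Omega E W Y z = k * act (J Y) E z.
Proof.
move=> sz cz sW sY JW Wdy; rewrite Omega_vertical //; apply/eqP; rewrite -subr_eq0; apply/eqP.
pose Phi Y : R^o :=
  act W (act (J Y) E) z - act (J (bracket W Y)) E z - k * act (J Y) E z.
have sJE X : smooth_near z X -> smooth_function_near z (act (J X) E).
  by move=> sX; apply: smooth_act_energy => //; exact: smooth_J.
apply: (@tensorial0 _ _ _ hTM _ z Phi _ _ _ c) => //; rewrite /Phi.
- move=> X X' sX XX'; apply: (congr2 (fun a b : R => a - b)).
    apply: (congr2 (fun a b : R => a - b)).
      apply: (act_eq hTM); last exact: sJE.
      by apply: act_fields_eq; apply: filterS XX' => q e; rewrite /J e.
    by apply: act_vec; rewrite /J (bracket_eqr hTM sW sX XX').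
  by congr (k * _); apply: act_vec; rewrite /J (at_pt_self hTM XX').
- move=> X X' sX sX'; rewrite J_vadd.
  have -> : act (vadd (J X) (J X')) E = (fun q => act (J X) E q + act (J X') E q).
    by apply/funext => q; exact: act_vadd.
  have e : J (bracket W (vadd X X')) z = vadd (J (bracket W X)) (J (bracket W X')) z.
    by rewrite /J (bracketDr hTM sW sX sX') /vadd mulmxDl.
  rewrite (act_vec _ e) !act_vadd (actD hTM _ (sJE _ sX) (sJE _ sX')).
  abstract_act => *; ring.
- move=> f X sf sX; rewrite J_vscale.
  have -> : act (vscale f (J X)) E = (fun q => f q * act (J X) E q).
    by apply/funext => q; exact: act_vscale.
  have e : J (bracket W (vscale f X)) z =
      vadd (vscale (act W f) (J X)) (vscale f (J (bracket W X))) z.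
    by rewrite /J (bracketZr hTM sW sX sf) /vadd /vscale mulmxDl -!scalemxAl.
  rewrite (act_vec _ e) !act_vadd !act_vscale (actM hTM _ sf (sJE _ sX)).
  rewrite /GRing.scale /=; abstract_act => *; ring.
- move=> xi; rewrite (act0 E (bracket_vertical_chart_field hM xi cz sW JW)) subr0.
  have Jxi : \forall q \near at_pt z, dy c (lsubmx xi) q = J (chart_field c xi) q.
    by apply: filterS (near_J_chart_field hM xi cz) => q ->; rewrite mul_Jmx.
  apply/eqP; rewrite subr_eq0 -(act_vec E (at_pt_self hTM Jxi)) -Wdy; apply/eqP.
  apply: esym; apply: (act_eq hTM); first exact: act_fields_eq.
  by apply: smooth_act_energy => //; exact: smooth_dy.
Qed.

(** Omega(W, d/dx^i) = W(E_{y^i}) for vertical W, and Omega is nondegenerate. *)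
Lemma vertical_eq0 c z W : slit z -> dom c z -> smooth_near z W ->
  (\forall q \near at_pt z, J W q = 0) ->
  (forall a, act W (act (dy c a) E) z = 0) -> W z = 0.
Proof.
move=> sz cz sW JW Wdy; have [_ _ _ _ nondeg] := hE; apply: (nondeg z sz W sW) => Y sY.
rewrite (@Omega_vertical_eigen c z 0) ?mul0r // => a.
by rewrite mul0r.
Qed.

Lemma act_liouville_energy X z : slit z ->
  act X (act C E) z = 2 * act X E z.
Proof.
move=> sz; apply: etrans (actZ hTM X 2 (smooth_energy sz)).
apply: esym; apply: (act_eq hTM); last first.
  apply: (smooth_functionM hTM); first exact: (smooth_function_cst hTM).
  exact: smooth_energy.
have [_ _ _ homog _] := hE.
by apply: filterS (slit_near hM sz) => q sq; rewrite homog.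
Qed.

(** E is homogeneous of degree 2 and [C, d/dy^i] = - d/dy^i, so that E_{y^i} is
homogeneous of degree 1. *)
Lemma liouville_dy_energy c z a : slit z -> dom c z ->
  act C (act (dy c a) E) z = act (dy c a) E z.
Proof.
move=> sz cz; have sC := smooth_liouville hM z; have sdy := smooth_dy hM a cz.
have := act_bracket hTM sC sdy (smooth_energy sz).
rewrite (act_liouville_energy _ sz).
have -> : act (bracket C (dy c a)) E z = - act (dy c a) E z.
  rewrite -act_vopp; apply: act_vec; exact: bracket_liouville_dy.
by abstract_act; lra.
Qed.

Lemma spray_Omega z X : slit z -> smooth_near z X -> Omega E S X z = - act X E z.
Proof. by move=> sz sX; have [_ h] := hS; exact: h. Qed.

(** On d/dy^i, the equation i_S Omega = - dE reads (JS)(E_{y^i}) = E_{y^i}, and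
C has the same derivatives by homogeneity; [vertical_eq0] applies to JS - C. *)
Lemma J_spray z : slit z -> J S z = C z.
Proof.
move=> sz; have cz := dom_chart_at hTM z; set c := chart_at z in cz.
have sS := smooth_spray sz; have sC := smooth_liouville hM z.
have sJS := smooth_J hM sS.
suff : vsub (J S) C z = 0 by move/eqP; rewrite subr_eq0 => /eqP.
apply: (vertical_eq0 sz cz); first exact: smooth_vsub.
  by apply: filterE => q; rewrite /vsub J_vadd J_vopp /vadd /vopp JJ J_liouville subr0.
move=> a; have sdy := smooth_dy hM a cz; rewrite act_vsub liouville_dy_energy //.
have := spray_Omega sz sdy; rewrite OmegaE.
have -> : act S (act (J (dy c a)) E) z = 0.
  rewrite -(act_cst z S 0); apply: (act_eq hTM).
    by apply: filterS (near_J_dy hM a cz) => q; exact: act0.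
  by apply: smooth_act_energy => //; exact: smooth_J.
have -> : act (J (bracket S (dy c a))) E z = act (bracket (J S) (dy c a)) E z.
  by apply: act_vec; rewrite bracket_J.
rewrite (act_bracket hTM sJS sdy (smooth_energy sz)).
by abstract_act; lra.
Qed.

Lemma near_J_spray z : slit z -> \forall q \near at_pt z, J S q = C q.
Proof. by move=> /(slit_near hM); apply: filterS => q; exact: J_spray. Qed.

(** Omega(S, S) = 0. *)
Lemma spray_energy z : slit z -> act S E z = 0.
Proof.
move=> sz; have := spray_Omega sz (smooth_spray sz); rewrite OmegaE subrr.
rewrite (act0 E (_ : J (bracket S S) z = 0)); first by abstract_act; lra.
by rewrite /J bracket_self mul0mx.
Qed.

(** The Euler-Lagrange equation of the energy: i_S Omega = - dE evaluated on
d/dx^i. *)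
Lemma spray_dy_energy c z a : slit z -> dom c z ->
  act S (act (dy c a) E) z = act (dx c a) E z.
Proof.
move=> sz cz; have sS := smooth_spray sz; have sdx := smooth_dx hM a cz.
have := spray_Omega sz sdx; rewrite OmegaE.
have -> : act S (act (J (dx c a)) E) z = act S (act (dy c a) E) z.
  apply: (act_eq hTM); first exact/act_fields_eq/near_J_dx.
  by apply: smooth_act_energy => //; exact: smooth_J.
have -> : act (dx c a) (act (J S) E) z = 2 * act (dx c a) E z.
  apply: etrans _ (act_liouville_energy _ sz); apply: (act_eq hTM).
    exact/act_fields_eq/near_J_spray.
  by apply: smooth_act_energy => //; exact: smooth_J.
rewrite (act0 E (_ : J (bracket S (dx c a)) z = 0)).
  by abstract_act; lra.
rewrite -bracket_J // -[RHS](bracket_liouville_dx hM a cz).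
apply: (bracket_eq hTM) => //; [exact: smooth_J|exact: near_J_spray|exact: filterE].
Qed.

(** S is homogeneous of degree 2: comparing the derivatives C(S(E_{y^i})) and
S(C(E_{y^i})) shows that [C, S] - S, which is vertical, kills E_{y^i}. The
premise holds by [J_bracket_J_spray]. *)
Lemma bracket_liouville_spray z : slit z ->
  (forall q X, slit q -> smooth_near q X -> J (bracket (J X) S) q = J X q) ->
  bracket C S z = S z.
Proof.
move=> sz JJS; have cz := dom_chart_at hTM z; set c := chart_at z in cz.
have sS := smooth_spray sz; have sC := smooth_liouville hM z.
have sCS := smooth_bracket hTM sC sS.
suff : vsub (bracket C S) S z = 0 by move/eqP; rewrite subr_eq0 => /eqP.
apply: (vertical_eq0 sz cz); first exact: smooth_vsub.
  apply: filterS (slit_near hM sz) => q sq.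
  rewrite /vsub J_vadd J_vopp /vadd /vopp J_spray //.
  have -> : J (bracket C S) q = J (bracket (J S) S) q.
    rewrite /J -(bracket_eq hTM (X := J S) (Y := S)) //.
    - exact/smooth_J/smooth_spray.
    - exact: smooth_spray.
    - exact: near_J_spray.
    - exact: filterE.
  by rewrite JJS ?J_spray ?subrr //; exact: smooth_spray.
move=> a; have sdy := smooth_dy hM a cz; have sdx := smooth_dx hM a cz.
have sdyE := smooth_act_energy sz sdy.
rewrite act_vsub spray_dy_energy // (act_bracket hTM sC sS sdyE).
have -> : act S (act C (act (dy c a) E)) z = act (dx c a) E z.
  apply: etrans _ (spray_dy_energy a sz cz); apply: (act_eq hTM); last exact: smooth_act.
  apply: filterS2 (slit_near hM sz) (at_pt_dom hTM cz) => q sq cq.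
  exact: liouville_dy_energy.
have -> : act C (act S (act (dy c a) E)) z = 2 * act (dx c a) E z.
  have -> : act C (act S (act (dy c a) E)) z = act C (act (dx c a) E) z.
    apply: (act_eq hTM); last exact: smooth_act.
    apply: filterS2 (slit_near hM sz) (at_pt_dom hTM cz) => q sq cq.
    exact: spray_dy_energy.
  have := act_bracket hTM sC sdx (smooth_energy sz).
  rewrite (act_liouville_energy _ sz) (act0 E (bracket_liouville_dx hM a cz)).
  by abstract_act; lra.
by abstract_act; lra.
Qed.

End spray.

(** * The Barthel connection *)

Lemma half_double {R : realType} {V : lmodType R} (v : V) : 2%:R^-1 *: (v + v) = v.
Proof.
rewrite scalerDr -scalerDl; have -> : 2%:R^-1 + 2%:R^-1 = 1 :> R by lra.
exact: scale1r.
Qed.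

Section barthel.
Context {R : realType} {n : nat} (M : charted R n).
Hypothesis hM : smooth_atlas M.
Local Notation TM := (tangent_bundle M).
Local Notation VF := (vfield TM).
Implicit Types (c : chart TM) (z : TM) (X Y Z W : VF) (a : 'rV[R]_n).
Let hTM : smooth_atlas TM := tangent_atlas hM.
Local Notation C := (@liouville R n M).
Variables (E : TM -> R) (hE : finsler_space E).
Variables (S : VF) (hS : canonical_spray E S).
Variables (F : TM -> 'M[R]_(n + n)) (hF : almost_complex_structure S F).

Let sS z : slit z -> smooth_near z S. Proof. exact: (smooth_spray hM hS). Qed.

Lemma hprojE X z : hproj S X z =
  2%:R^-1 *: (X z + (bracket (J X) S z - J (bracket X S) z)).
Proof. by []. Qed.

Lemma smooth_hproj z X : slit z -> smooth_near z X -> smooth_near z (hproj S X).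
Proof.
move=> sz sX; apply: (smooth_vscale hTM); first exact: (smooth_function_cst hTM).
apply: (smooth_vadd hTM) => //; apply: (smooth_vsub hTM).
  by apply: (smooth_bracket hTM); [exact: smooth_J|exact: sS].
by apply: (smooth_J hM); apply: (smooth_bracket hTM) => //; exact: sS.
Qed.

Lemma hproj_FJ z X : slit z -> smooth_near z X -> X z *m Jmx *m F z = hproj S X z.
Proof. by move=> sz sX; have [] := hF sz sX. Qed.

Lemma hproj_eq z X X' : slit z -> smooth_near z X -> smooth_near z X' ->
  X z = X' z -> hproj S X z = hproj S X' z.
Proof. by move=> sz sX sX' e; rewrite -!hproj_FJ // e. Qed.

(** hJX = FJJX = 0, while hJX is by definition one half of JX - J[JX, S]. *)
Lemma J_bracket_J_spray z X : slit z -> smooth_near z X ->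
  J (bracket (J X) S) z = J X z.
Proof.
move=> sz sX; have sJX := smooth_J hM sX.
have := hproj_FJ sz sJX; rewrite hprojE.
rewrite [J X z *m Jmx]JJ mul0mx.
rewrite (bracketC _ (J (J X))) (bracket0r hTM) ?oppr0 ?sub0r //; first last.
- by apply: filterE => q; exact: JJ.
- exact: smooth_J.
- exact: sS.
by move=> /esym/eqP; rewrite scaler_eq0 invr_eq0 pnatr_eq0 /= subr_eq0 => /eqP.
Qed.

Lemma J_hproj z X : slit z -> smooth_near z X -> J (hproj S X) z = J X z.
Proof.
move=> sz sX.
have -> : J (hproj S X) z =
    2%:R^-1 *: (J X z + (J (bracket (J X) S) z - J (J (bracket X S)) z)).
  by rewrite {1}/J hprojE -scalemxAl (mulmxDl (X z)) (mulmxDl (bracket (J X) S z)) mulNmx.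
rewrite J_bracket_J_spray // JJ subr0.
exact: half_double.
Qed.

Lemma vector_extension z (xi : 'rV[R]_(n + n)) :
  exists2 X, smooth_near z X & X z = xi.
Proof.
have cz := dom_chart_at hTM z; exists (chart_field (chart_at z) xi).
  exact: smooth_chart_field.
by rewrite -[in LHS](components_chart_at hTM z xi) chart_field_components.
Qed.

Lemma mulmx_ext (A B : 'M[R]_(n + n)) :
  (forall xi : 'rV[R]_(n + n), xi *m A = xi *m B) -> A = B.
Proof. by move=> AB; apply/row_matrixP => i; rewrite !rowE. Qed.

Lemma JFJ z : slit z -> Jmx *m F z *m Jmx = Jmx.
Proof.
move=> sz; apply: mulmx_ext => xi; have [X sX <-] := vector_extension z xi.
by rewrite !mulmxA hproj_FJ // -[RHS](J_hproj sz sX).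
Qed.

Lemma JFF z : slit z -> Jmx *m F z *m F z = - Jmx.
Proof.
move=> sz; apply: mulmx_ext => xi; have [X sX <-] := vector_extension z xi.
by rewrite !mulmxA hproj_FJ // mulmxN; have [_] := hF sz sX.
Qed.

(** Matrices act on rows, so that F z *m Jmx is the composite JF, and the claim
is that JF is the vertical projector. The two preceding lemmas give F the rows
of blocks (- d, b) and (1, d). *)
Lemma FJ z : slit z -> F z *m Jmx = 1%:M - Jmx *m F z.
Proof.
move=> sz; have := JFF sz; have := JFJ sz.
rewrite -[F z](submxK) /Jmx !mulmx_block !mul0mx !mulmx0 !mul1mx !mulmx1 !addr0 !add0r.
rewrite opp_block_mx !oppr0 => /eq_block_mx[_ c1 _ _] /eq_block_mx[+ _ _ _].
rewrite c1 mul1mx mulmx1 => /eqP; rewrite addr_eq0 => /eqP ->.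
by rewrite scalar_mx_block opp_block_mx add_block_mx !oppr0 !addr0 subrr add0r.
Qed.

Lemma hproj_hproj z X : slit z -> smooth_near z X ->
  hproj S (hproj S X) z = hproj S X z.
Proof.
move=> sz sX; rewrite -hproj_FJ //; last exact: smooth_hproj.
by rewrite [hproj S X z *m Jmx]J_hproj // hproj_FJ.
Qed.

Lemma hproj_vadd z X Y : slit z -> smooth_near z X -> smooth_near z Y ->
  hproj S (vadd X Y) z = hproj S X z + hproj S Y z.
Proof.
move=> sz sX sY; rewrite -!hproj_FJ //; last exact: smooth_vadd.
by rewrite /vadd !mulmxDl.
Qed.

Lemma hproj_vscale z f X : slit z -> smooth_function_near z f -> smooth_near z X ->
  hproj S (vscale f X) z = f z *: hproj S X z.
Proof.
move=> sz sf sX; rewrite -!hproj_FJ //; last exact: smooth_vscale.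
by rewrite /vscale -!scalemxAl.
Qed.

Lemma vprojE z X : vproj S X z = X z - hproj S X z.
Proof.
have complement (x b : 'rV[R]_(n + n)) : 2%:R^-1 *: (x - b) = x - 2%:R^-1 *: (x + b).
  by rewrite -[in X in _ = X - _](half_double x) -scalerBr opprD addrA addrK.
exact: complement.
Qed.

Lemma J_vproj z X : slit z -> smooth_near z X -> J (vproj S X) z = 0.
Proof.
by move=> sz sX; rewrite /J vprojE mulmxBl -[X in _ - X](esym (J_hproj sz sX)) subrr.
Qed.

Lemma smooth_vproj z X : slit z -> smooth_near z X -> smooth_near z (vproj S X).
Proof.
move=> sz sX.
apply: (smooth_near_eq hTM (X := vsub X (hproj S X))).
  by apply: filterE => q; rewrite vprojE.
by apply: smooth_vsub => //; exact: smooth_hproj.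
Qed.

(** FX = - JX + hW if JW is the vertical part of X: the smoothness of F is
inherited from J and h. *)
Lemma smooth_Fop z X : slit z -> smooth_near z X -> smooth_near z (Fop F X).
Proof.
move=> sz sX.
have JvX : \forall q \near at_pt z, J (vproj S X) q = 0.
  apply: filterS2 (slit_near hM sz) (smooth_near_near hTM sX) => q sq sXq.
  exact: J_vproj.
have [W sW vW] := vertical_lift hM (smooth_vproj sz sX) JvX.
apply: (smooth_near_eq hTM (X := vadd (vopp (J X)) (hproj S W))).
  have good : \forall q \near at_pt z, [/\ slit q, smooth_near q X & smooth_near q W].
    by apply: filterS3 (slit_near hM sz) (smooth_near_near hTM sX) (smooth_near_near hTM sW).
  apply: filterS2 vW good => q + [sq sXq sWq]; rewrite vprojE => vW'.
  have -> : Fop F X q = hproj S X q *m F q + J W q *m F q.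
    by rewrite -mulmxDl -vW' addrC subrK.
  rewrite [J W q *m F q]hproj_FJ //; congr (_ + _).
  by rewrite -hproj_FJ // -[RHS]mulmxA -[RHS]mulmxA [Jmx *m _]mulmxA JFF // mulmxN.
apply: smooth_vadd => //; last exact: smooth_hproj.
by apply: (smooth_vopp hTM); exact: smooth_J.
Qed.

(** The energy is constant along horizontal curves: in 2 hX E = X E + [JX, S] E
- J[X, S] E, use S E = 0 and i_S Omega = - dE. *)
Lemma hproj_energy z X : slit z -> smooth_near z X -> act (hproj S X) E z = 0.
Proof.
move=> sz sX; have sE := smooth_energy hM hE sz; have sSz := sS sz.
have sJX := smooth_J hM sX; have sJS := smooth_J hM sSz.
rewrite /hproj /Gamma act_vscale act_vadd act_vsub.
have := spray_Omega hS sz sX; rewrite OmegaE.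
have -> : act X (act (J S) E) z = 2 * act X E z.
  apply: etrans _ (act_liouville_energy hM hE _ sz); apply: (act_eq hTM).
    exact/act_fields_eq/(near_J_spray hM hE hS).
  exact: (smooth_act_energy hM hE).
have -> : act (J (bracket S X)) E z = - act (J (bracket X S)) E z.
  by rewrite -act_vopp; apply: act_vec; rewrite /J /vopp bracketC mulNmx.
have := act_bracket hTM sJX sSz sE.
have -> : act (J X) (act S E) z = 0.
  rewrite -(act_cst z (J X) 0); apply: (act_eq hTM).
    by apply: filterS (slit_near hM sz) => q; exact: (spray_energy hM hS).
  exact: (smooth_act_energy hM hE).
move=> -> e; apply/eqP; rewrite mulf_eq0; apply/orP; right; apply/eqP.
by move: e; abstract_act; lra.
Qed.

Lemma near_bracket_liouville_spray z : slit z ->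
  \forall q \near at_pt z, bracket C S q = S q.
Proof.
move=> sz; apply: filterS (slit_near hM sz) => q sq.
apply: (bracket_liouville_spray hM hE hS) => // *; exact: J_bracket_J_spray.
Qed.

(** J[d/dx^i, S] = 0, for J commutes with the bracket by d/dx^i, JS = C, and [C,
d/dx^i] = 0. *)
Lemma near_hproj_dx c z a : slit z -> dom c z ->
  \forall q \near at_pt z, hproj S (dx c a) q =
    vscale (fun=> 2%:R^-1) (vadd (dx c a) (bracket (dy c a) S)) q.
Proof.
move=> sz cz.
apply: filterS2 (slit_near hM sz) (at_pt_dom hTM cz) => q sq cq.
have sdx := smooth_dx hM a cq.
rewrite hprojE /vscale /vadd; congr (_ *: (_ + _)).
have -> : J (bracket (dx c a) S) q = 0.
  rewrite /J bracketC mulNmx [X in - X](esym (bracket_J hM _ cq (sS sq))).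
  rewrite (bracket_eq hTM (X' := C) (Y' := dx c a)) //.
  - by rewrite bracket_liouville_dx // oppr0.
  - exact: (smooth_J hM (sS sq)).
  - exact: (near_J_spray hM hE hS).
  - exact: filterE.
rewrite subr0; apply: (bracket_eq hTM) => //.
- exact: (smooth_J hM sdx).
- exact: sS.
- exact: near_J_dx.
- exact: filterE.
Qed.

(** The Barthel connection is homogeneous. Here this is the Jacobi identity for
C, d/dy^i and S, with [C, S] = S and [C, d/dy^i] = - d/dy^i. *)
Lemma bracket_hproj_dx_liouville c z a : slit z -> dom c z ->
  bracket (hproj S (dx c a)) C z = 0.
Proof.
move=> sz cz; have sdx := smooth_dx hM a cz; have sdy := smooth_dy hM a cz.
have sC := smooth_liouville hM z; have sSz := sS sz.
have sdyS := smooth_bracket hTM sdy sSz.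
have s2 := smooth_function_cst hTM z (2%:R^-1).
have ssum := smooth_vadd hTM sdx sdyS.
rewrite bracketC (bracket_eqr hTM sC (smooth_hproj sz sdx) (near_hproj_dx a sz cz)).
rewrite (bracketZr hTM sC ssum s2) act_cst scale0r add0r (bracketDr hTM sC sdx sdyS).
rewrite bracket_liouville_dx // add0r (jacobi hTM sC sdy sSz).
rewrite (bracket_eqr hTM sdy (smooth_bracket hTM sC sSz) (near_bracket_liouville_spray sz)).
have -> : bracket (bracket C (dy c a)) S z = bracket (vopp (dy c a)) S z.
  apply: (bracket_eq hTM) => //.
  - exact: smooth_bracket.
  - by apply: filterS (at_pt_dom hTM cz) => q cq; exact: bracket_liouville_dy.
  - exact: filterE.
by rewrite (bracketNl hTM sdy sSz) addNr scaler0 oppr0.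
Qed.

End barthel.

(** * Linear connections and their curvature *)

Section connections.
Context {R : realType} {m : nat} (N : charted R m).
Hypothesis hN : smooth_atlas N.
Variables (O : set N) (D : vfield N -> vfield N -> vfield N).
Hypotheses (oO : open_in O) (hD : linear_connection O D).
Implicit Types (z : N) (X Y Z : vfield N).

Lemma connection_smooth z X Y : O z -> smooth_near z X -> smooth_near z Y ->
  smooth_near z (D X Y).
Proof. by move=> /hD [h _ _ _ _]; exact: h. Qed.

Lemma connection_eq z X X' Y Y' : O z -> smooth_near z X -> smooth_near z Y ->
  (\forall q \near at_pt z, X q = X' q) -> (\forall q \near at_pt z, Y q = Y' q) ->
  D X Y z = D X' Y' z.
Proof.
move=> /hD [_ h _ _ _] sX sY eX eY.
by apply: h => //; apply/(germ_eqP hN).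
Qed.

Lemma connection_near_eq z X X' Y Y' : O z -> smooth_near z X -> smooth_near z Y ->
  (\forall q \near at_pt z, X q = X' q) -> (\forall q \near at_pt z, Y q = Y' q) ->
  \forall q \near at_pt z, D X Y q = D X' Y' q.
Proof.
move=> Oz sX sY eX eY.
have good : \forall q \near at_pt z, [/\ O q, smooth_near q X & smooth_near q Y].
  by apply: filterS3 (open_in_near hN oO Oz) (smooth_near_near hN sX) (smooth_near_near hN sY).
apply: filterS3 good (at_pt_near hN eX) (at_pt_near hN eY) => q [Oq sXq sYq] eXq eYq.
exact: connection_eq.
Qed.

Lemma connectionDl z X X' Y : O z -> smooth_near z X -> smooth_near z X' ->
  smooth_near z Y -> D (vadd X X') Y z = D X Y z + D X' Y z.
Proof. by move=> /hD [_ _ [h _] _ _]; exact: h. Qed.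

Lemma connectionZl z f X Y : O z -> smooth_function_near z f -> smooth_near z X ->
  smooth_near z Y -> D (vscale f X) Y z = f z *: D X Y z.
Proof. by move=> /hD [_ _ [_ h] _ _]; exact: h. Qed.

Lemma connectionDr z X Y Y' : O z -> smooth_near z X -> smooth_near z Y ->
  smooth_near z Y' -> D X (vadd Y Y') z = D X Y z + D X Y' z.
Proof. by move=> /hD [_ _ _ h _]; exact: h. Qed.

Lemma connectionZr z f X Y : O z -> smooth_function_near z f -> smooth_near z X ->
  smooth_near z Y -> D X (vscale f Y) z = act X f z *: Y z + f z *: D X Y z.
Proof. by move=> /hD [_ _ _ _ h]; exact: h. Qed.

Lemma connectionBl z X X' Y : O z -> smooth_near z X -> smooth_near z X' ->
  smooth_near z Y -> D (vsub X X') Y z = D X Y z - D X' Y z.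
Proof.
move=> Oz sX sX' sY; have s1 := smooth_function_cst hN z (-1).
rewrite connectionDl //; last exact: smooth_vopp.
by rewrite vopp_scale connectionZl // scaleN1r.
Qed.

Lemma connectionBr z X Y Y' : O z -> smooth_near z X -> smooth_near z Y ->
  smooth_near z Y' -> D X (vsub Y Y') z = D X Y z - D X Y' z.
Proof.
move=> Oz sX sY sY'; have s1 := smooth_function_cst hN z (-1).
rewrite connectionDr //; last exact: smooth_vopp.
by rewrite vopp_scale connectionZr // act_cst scale0r add0r scaleN1r.
Qed.

Lemma connection0r z X Y : O z -> smooth_near z X -> smooth_near z Y ->
  (\forall q \near at_pt z, Y q = 0) -> D X Y z = 0.
Proof.
move=> Oz sX sY Y0; have s0 := smooth_function_cst hN z 0.
rewrite (@connection_eq z X X Y (vscale (fun=> 0) Y)) //.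
- by rewrite connectionZr // act_cst !scale0r addr0.
- exact: filterE.
- by apply: filterS Y0 => q ->; rewrite /vscale scale0r.
Qed.

Lemma curvatureE A B V z :
  curvature D A B V z = D A (D B V) z - D B (D A V) z - D (bracket A B) V z.
Proof. by []. Qed.

Lemma curvature_eq z A A' B B' V V' : O z ->
  smooth_near z A -> smooth_near z B -> smooth_near z V ->
  (\forall q \near at_pt z, A q = A' q) -> (\forall q \near at_pt z, B q = B' q) ->
  (\forall q \near at_pt z, V q = V' q) ->
  curvature D A B V z = curvature D A' B' V' z.
Proof.
move=> Oz sA sB sV eA eB eV; rewrite !curvatureE.
rewrite (connection_eq Oz sA (connection_smooth Oz sB sV) eA
  (connection_near_eq Oz sB sV eB eV)).
rewrite (connection_eq Oz sB (connection_smooth Oz sA sV) eB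
  (connection_near_eq Oz sA sV eA eV)).
congr (_ - _); apply: connection_eq => //; first exact: smooth_bracket.
have good : \forall q \near at_pt z, smooth_near q A /\ smooth_near q B.
  by apply: filterS2 (smooth_near_near hN sA) (smooth_near_near hN sB).
apply: filterS3 good (at_pt_near hN eA) (at_pt_near hN eB) => q [sAq sBq] eAq eBq.
exact: bracket_eq.
Qed.

Lemma curvatureDl z A A' B V : O z -> smooth_near z A -> smooth_near z A' ->
  smooth_near z B -> smooth_near z V ->
  curvature D (vadd A A') B V z = curvature D A B V z + curvature D A' B V z.
Proof.
move=> Oz sA sA' sB sV; rewrite !curvatureE.
have sDA := connection_smooth Oz sA sV; have sDA' := connection_smooth Oz sA' sV.
have sDB := connection_smooth Oz sB sV.
have sAA' := smooth_vadd hN sA sA'.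
have good : \forall q \near at_pt z, [/\ O q, smooth_near q A & smooth_near q A'].
  by apply: filterS3 (open_in_near hN oO Oz) (smooth_near_near hN sA) (smooth_near_near hN sA').
have good' : \forall q \near at_pt z, smooth_near q B /\ smooth_near q V.
  by apply: filterS2 (smooth_near_near hN sB) (smooth_near_near hN sV).
have e1 : D B (D (vadd A A') V) z = D B (D A V) z + D B (D A' V) z.
  apply: etrans _ (connectionDr Oz sB sDA sDA'); apply: connection_eq => //.
  - exact: connection_smooth.
  - exact: filterE.
  - by apply: filterS2 good good' => q [Oq sAq sAq'] [_ sVq]; exact: connectionDl.
have e2 : D (bracket (vadd A A') B) V z = D (bracket A B) V z + D (bracket A' B) V z.
  have sAB := smooth_bracket hN sA sB; have sAB' := smooth_bracket hN sA' sB.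
  have sb : smooth_near z (bracket (vadd A A') B) by exact: smooth_bracket.
  apply: etrans _ (connectionDl Oz sAB sAB' sV).
  apply: (connection_eq Oz sb sV); last exact: filterE.
  by apply: filterS2 good good' => q [Oq sAq sAq'] [sBq _]; exact: bracketDl.
have arith (a a' b b' c c' : 'rV[R]_m) :
    (a + a') - (b + b') - (c + c') = (a - b - c) + (a' - b' - c').
  by apply/rowP => j; rewrite !mxE; ring.
apply: etrans (congr2 (fun a b => a - b) (congr2 (fun a b => a - b)
  (connectionDl Oz sA sA' sDB) e1) e2) _.
exact: arith.
Qed.

(** The terms in B(f) coming from D_B (f D_A V) and from [fA, B] cancel. *)
Lemma curvatureZl z f A B V : O z -> smooth_function_near z f -> smooth_near z A ->
  smooth_near z B -> smooth_near z V ->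
  curvature D (vscale f A) B V z = f z *: curvature D A B V z.
Proof.
move=> Oz sf sA sB sV; rewrite !curvatureE.
have sDA := connection_smooth Oz sA sV; have sDB := connection_smooth Oz sB sV.
have sfA := smooth_vscale hN sf sA; have sAB := smooth_bracket hN sA sB.
have good : \forall q \near at_pt z, [/\ O q, smooth_near q A & smooth_function_near q f].
  by apply: filterS3 (open_in_near hN oO Oz) (smooth_near_near hN sA)
    (smooth_function_near_near hN sf).
have good' : \forall q \near at_pt z, smooth_near q B /\ smooth_near q V.
  by apply: filterS2 (smooth_near_near hN sB) (smooth_near_near hN sV).
have sBf : smooth_function_near z (act B f) by exact: smooth_act.
have sNBf : smooth_function_near z (fun q => -1 * act B f q).
  by apply: (smooth_functionM hN) => //; exact: (smooth_function_cst hN).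
have e1 : D B (D (vscale f A) V) z = act B f z *: D A V z + f z *: D B (D A V) z.
  apply: etrans _ (connectionZr Oz sf sB sDA); apply: connection_eq => //.
  - exact: connection_smooth.
  - exact: filterE.
  - by apply: filterS2 good good' => q [Oq sAq sfq] [_ sVq]; exact: connectionZl.
have e2 : D (bracket (vscale f A) B) V z =
    - act B f z *: D A V z + f z *: D (bracket A B) V z.
  have sNA := smooth_vscale hN sNBf sA; have sfAB := smooth_vscale hN sf sAB.
  have n1 : - act B f z = -1 * act B f z by rewrite mulN1r.
  rewrite n1.
  apply: etrans _ (congr2 +%R (connectionZl Oz sNBf sA sV) (connectionZl Oz sf sAB sV)).
  have sb : smooth_near z (bracket (vscale f A) B) by exact: smooth_bracket.
  apply: etrans _ (connectionDl Oz sNA sfAB sV).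
  apply: (connection_eq Oz sb sV); last exact: filterE.
  apply: filterS2 good good' => q [Oq sAq sfq] [sBq _].
  by rewrite bracketZl // /vadd /vscale mulN1r.
have arith (k l : R) (a b c d u v w : 'rV[R]_m) :
    u = k *: a -> v = l *: d + k *: b -> w = - l *: d + k *: c ->
    u - v - w = k *: (a - b - c).
  by move=> -> -> ->; apply/rowP => j; rewrite !mxE; ring.
have e0 := connectionZl Oz sf sA sDB.
exact: (arith _ _ _ _ _ _ _ _ _ e0 e1 e2).
Qed.

End connections.

(** * The Cartan tensors along the spray *)

Section cartan.
Context {R : realType} {n : nat} (M : charted R n).
Hypothesis hM : smooth_atlas M.
Local Notation TM := (tangent_bundle M).
Local Notation VF := (vfield TM).
Implicit Types (c : chart TM) (z : TM) (X Y Z W V : VF) (a b : 'rV[R]_n).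
Let hTM : smooth_atlas TM := tangent_atlas hM.
Local Notation C := (@liouville R n M).
Variables (E : TM -> R) (hE : finsler_space E).
Variables (S : VF) (hS : canonical_spray E S).
Variables (F : TM -> 'M[R]_(n + n)) (hF : almost_complex_structure S F).

Let sS z : slit z -> smooth_near z S. Proof. exact: (smooth_spray hM hS). Qed.

(** i_C Omega = d_J E, by the homogeneity of E_{y^i}. *)
Lemma Omega_J_spray z B : slit z -> smooth_near z B ->
  Omega E (J S) B z = act (J B) E z.
Proof.
move=> sz sB; have cz := dom_chart_at hTM z.
apply: etrans (mul1r _).
apply: (Omega_vertical_eigen hM hE sz cz) => //.
- exact: (smooth_J hM (sS sz)).
- by apply: filterE => q; exact: JJ.
- move=> a; rewrite mul1r -(liouville_dy_energy hM hE a sz cz).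
  apply: act_vec; exact: (J_spray hM hE hS).
Qed.

Lemma Omega_zerol z A B : slit z -> smooth_near z A -> smooth_near z B ->
  (\forall q \near at_pt z, A q = 0) -> Omega E A B z = 0.
Proof.
move=> sz sA sB A0; rewrite (Omega_vertical hM hE) //; last first.
  by apply: filterS A0 => q e; rewrite /J e mul0mx.
rewrite (act0 _ (at_pt_self hTM A0)) (act0 E (_ : J (bracket A B) z = 0)) ?subr0 //.
by rewrite /J bracketC (bracket0r hTM) // oppr0 mul0mx.
Qed.

Lemma near_metric_J_spray_J z Z : slit z -> smooth_near z Z ->
  \forall q \near at_pt z, act (J Z) E q = metric E F (J S) (J Z) q.
Proof.
move=> sz sZ; apply: filterS2 (slit_near hM sz) (smooth_near_near hTM sZ) => q sq sZq.
have sFJZ := smooth_Fop hM hS hF sq (smooth_J hM sZq).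
apply: esym; apply: etrans (Omega_J_spray sq sFJZ) _.
by apply: act_vec; rewrite /J /Fop -mulmxA -mulmxA (mulmxA Jmx) (JFJ hM hS hF).
Qed.

Section second_tensor.
Variables (T' : tensor2 M) (hT' : second_cartan_tensor E S F T').

(** For X = d/dx^i and Z = d/dx^j, twice Omega(T'(X, S), Z) is hX(JZ E) - g([hX,
C], JZ) - v[hX, JZ] E. The fields hX and C commute, and v[hX, JZ] E = [hX, JZ] E
= hX(JZ E) because horizontal fields kill E. *)
Lemma second_cartan_tensor_spray c z a : slit z -> dom c z ->
  T' z (dx c a z) (S z) = 0.
Proof.
move=> sz cz; have [Tss Tdef] := hT'.
have [_ _ _ Tvert Tsmooth] := Tss z sz.
have sdx := smooth_dx hM a cz; have sSz := sS sz.
have sW := Tsmooth _ _ sdx sSz.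
have JW : \forall q \near at_pt z, J (tapp T' (dx c a) S) q = 0.
  apply: filterS (slit_near hM sz) => q sq.
  by have [_ _ _ Tv _] := Tss q sq; exact: Tv.
apply: (vertical_eq0 hM hE sz cz sW JW) => b.
have sdb := smooth_dx hM b cz.
have sJdb := smooth_J hM sdb; have sJS := smooth_J hM sSz.
have sh := smooth_hproj hM hS sz sdx.
have sJdbE := smooth_act_energy hM hE sz sJdb.
have -> : act (tapp T' (dx c a) S) (act (dy c b) E) z =
    Omega E (tapp T' (dx c a) S) (dx c b) z.
  rewrite (Omega_vertical hM hE sz sW sdb JW).
  rewrite (act0 E (bracket_vertical_chart_field hM _ cz sW JW)) subr0.
  apply: esym; apply: (act_eq hTM) => //.
  by apply: act_fields_eq; exact: near_J_dx.
rewrite Tdef // /lie_derivative2.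
have -> : act (hproj S (dx c a)) (metric E F (J S) (J (dx c b))) z =
    act (hproj S (dx c a)) (act (J (dx c b)) E) z.
  by apply: esym; apply: (act_eq hTM) => //; exact: near_metric_J_spray_J.
have -> : metric E F (bracket (hproj S (dx c a)) (J S)) (J (dx c b)) z = 0.
  apply: Omega_zerol => //.
  - exact: smooth_bracket.
  - exact: (smooth_Fop hM hS hF).
  apply: filterS2 (slit_near hM sz) (at_pt_dom hTM cz) => q sq cq.
  rewrite -(bracket_hproj_dx_liouville hM hE hS hF a sq cq).
  apply: (bracket_eqr hTM).
  - exact: (smooth_hproj hM hS sq (smooth_dx hM a cq)).
  - exact: (smooth_J hM (sS sq)).
  - exact: (near_J_spray hM hE hS).
have sB : smooth_near z (bracket (hproj S (dx c a)) (J (dx c b))) by exact: smooth_bracket.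
set B := bracket _ (J (dx c b)) in sB *.
have -> : metric E F (J S) B z = act B E z.
  rewrite /metric (Omega_J_spray sz (smooth_Fop hM hS hF sz sB)).
  have -> : act (J (Fop F B)) E z = act (vproj S B) E z.
    apply: act_vec; rewrite vprojE -(hproj_FJ hF sz sB) /J /Fop -mulmxA (FJ hM hS hF sz).
    by rewrite mulmxBr mulmx1 mulmxA.
  rewrite (act_vec (X' := vsub B (hproj S B))) ?vprojE // act_vsub.
  by rewrite (hproj_energy hM hE hS sz sB) subr0.
rewrite (act_bracket hTM sh sJdb (smooth_energy hM hE sz)).
have -> : act (J (dx c b)) (act (hproj S (dx c a)) E) z = 0.
  rewrite -(act_cst z (J (dx c b)) 0); apply: (act_eq hTM).
    apply: filterS2 (slit_near hM sz) (smooth_near_near hTM sdx) => q sq sdxq.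
    exact: (hproj_energy hM hE hS).
  exact: (smooth_act_energy hM hE).
by abstract_act => *; ring.
Qed.

End second_tensor.

Section first_tensor.
Variables (T : tensor2 M) (hT : first_cartan_tensor E F T).

(** For coordinate fields X and Z, [JX, Z] = 0 and twice Omega(T(X, S), Z) is
JX(JZ E) - g(J[JX, S], JZ) with J[JX, S] = JX. Since JhZ = JZ and the bracket of
coordinate fields vanishes, g(JX, JZ) = Omega(JX, hZ) = JX(JZ E). *)
Lemma first_cartan_tensor_spray z (xi : 'rV[R]_(n + n)) : slit z ->
  T z xi (S z) = 0.
Proof.
move=> sz; have cz := dom_chart_at hTM z; set c := chart_at z in cz.
have [Tss Tdef] := hT.
have [_ _ _ Tvert Tsmooth] := Tss z sz.
pose X : VF := chart_field c xi; have sX : smooth_near z X by exact: smooth_chart_field.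
have Xz : X z = xi.
  by rewrite /X -[in LHS](components_chart_at hTM z xi) chart_field_components.
have sSz := sS sz.
have sW := Tsmooth _ _ sX sSz.
have JW : \forall q \near at_pt z, J (tapp T X S) q = 0.
  apply: filterS (slit_near hM sz) => q sq.
  by have [_ _ _ Tv _] := Tss q sq; exact: Tv.
rewrite -Xz; apply: (vertical_eq0 hM hE sz cz sW JW) => b.
have sdb := smooth_dx hM b cz; have sdyb := smooth_dy hM b cz.
have sJdb := smooth_J hM sdb; have sJS := smooth_J hM sSz.
have sJX := smooth_J hM sX.
have sJdbE := smooth_act_energy hM hE sz sJdb.
pose a := lsubmx xi; have sdya := smooth_dy hM a cz.
have JXdy : \forall q \near at_pt z, J X q = dy c a q.
  by apply: filterS (near_J_chart_field hM xi cz) => q ->; rewrite mul_Jmx.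
have -> : act (tapp T X S) (act (dy c b) E) z = Omega E (tapp T X S) (dx c b) z.
  rewrite (Omega_vertical hM hE sz sW sdb JW).
  rewrite (act0 E (bracket_vertical_chart_field hM _ cz sW JW)) subr0.
  apply: esym; apply: (act_eq hTM) => //.
  by apply: act_fields_eq; exact: near_J_dx.
rewrite Tdef // /lie_derivative2 /Jmetric.
have -> : act (J X) (metric E F (J S) (J (dx c b))) z = act (J X) (act (J (dx c b)) E) z.
  by apply: esym; apply: (act_eq hTM) => //; exact: near_metric_J_spray_J.
have sb1 : smooth_near z (bracket (J X) S) by exact: smooth_bracket.
have sb2 : smooth_near z (bracket (J X) (dx c b)) by exact: smooth_bracket.
have -> : metric E F (J S) (J (bracket (J X) (dx c b))) z = 0.
  have := near_metric_J_spray_J sz sb2 => /(at_pt_self hTM) <-.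
  apply: act0; rewrite /J (bracket_eq hTM (X' := dy c a) (Y' := dx c b)) //.
    by rewrite bracket_chart_fields // mul0mx.
  exact: filterE.
set A := J (bracket (J X) S).
have sA : smooth_near z A by exact: (smooth_J hM sb1).
pose B := Fop F (J (dx c b)).
have sB : smooth_near z B by exact: (smooth_Fop hM hS hF).
have JBdy : \forall q \near at_pt z, J B q = J (dx c b) q.
  apply: filterS (slit_near hM sz) => q sq.
  by rewrite /J /B /Fop -mulmxA -mulmxA (mulmxA Jmx) (JFJ hM hS hF).
have AJX : \forall q \near at_pt z, A q = J X q.
  apply: filterS2 (slit_near hM sz) (smooth_near_near hTM sX) => q sq sXq.
  exact: (J_bracket_J_spray hM hS hF).
have -> : metric E F A (J (dx c b)) z = act (J X) (act (J (dx c b)) E) z.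
  rewrite /metric -/B (Omega_vertical hM hE sz sA sB); last first.
    by apply: filterE => q; exact: JJ.
  have -> : act (J (bracket A B)) E z = 0.
    apply: act0.
    have -> : J (bracket A B) z = - J (bracket B (dy c a)) z.
      rewrite /J bracketC mulNmx; congr (- (_ *m _)).
      apply: (bracket_eqr hTM sB sA).
      by apply: filterS2 AJX JXdy => q -> ->.
    rewrite -(bracket_J hM _ cz sB).
    rewrite (bracket_eq hTM (X' := dy c b) (Y' := dy c a)).
    - by rewrite /dy bracket_chart_fields // oppr0.
    - exact: (smooth_J hM sB).
    - exact: sdya.
    - by apply: filterS2 JBdy (near_J_dx hM b cz) => q -> ->.
    - exact: filterE.
  rewrite subr0 (act_vec _ (at_pt_self hTM AJX)).
  by apply: esym; apply: (act_eq hTM) => //; apply: act_fields_eq; apply: filterS JBdy => q ->.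
by abstract_act => *; ring.
Qed.

End first_tensor.

End cartan.

(** * Nullity fields of the h-curvature *)

Lemma near_and3 {R : realType} {m : nat} (N : charted R m) (z : N) (P Q H : set N) :
  at_pt z P -> at_pt z Q -> at_pt z H -> \forall x \near at_pt z, [/\ P x, Q x & H x].
Proof. by move=> GP GQ GH; apply: filterS3 GP GQ GH. Qed.

Section nullity.
Context {R : realType} {n : nat} (M : charted R n).
Hypothesis hM : smooth_atlas M.
Local Notation TM := (tangent_bundle M).
Local Notation VF := (vfield TM).
Implicit Types (c : chart TM) (z : TM) (X Y Z W V : VF) (a b : 'rV[R]_n).
Let hTM : smooth_atlas TM := tangent_atlas hM.
Local Notation C := (@liouville R n M).
Variables (E : TM -> R) (hE : finsler_space E).
Variables (S : VF) (hS : canonical_spray E S).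
Variables (F : TM -> 'M[R]_(n + n)) (hF : almost_complex_structure S F).
Variables (D0 : VF -> VF -> VF) (hD0 : berwald_connection S F D0).
Variables (T T' : tensor2 M).
Hypotheses (hT : first_cartan_tensor E F T) (hT' : second_cartan_tensor E S F T').
Variables (D : VF -> VF -> VF) (hD : cartan_connection S F D0 T T' D).

Let sS z : slit z -> smooth_near z S. Proof. exact: (smooth_spray hM hS). Qed.
Let sJ z X : smooth_near z X -> smooth_near z (J X). Proof. exact: (smooth_J hM). Qed.
Let sh z X : slit z -> smooth_near z X -> smooth_near z (hproj S X).
Proof. exact: (smooth_hproj hM hS). Qed.
Let lin : linear_connection (@slit R n M) D. Proof. by case: hD. Qed.
Let oslit : open_in (@slit R n M) := open_slit hM.
Let nslit z : slit z -> \forall q \near at_pt z, slit q := @slit_near _ _ _ hM z.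

Lemma vproj_eq0 z X : slit z -> smooth_near z X -> X z = 0 -> vproj S X z = 0.
Proof. by move=> sz sX X0; rewrite vprojE -(hproj_FJ hF sz sX) X0 !mul0mx subrr. Qed.

Lemma near_hproj_eq z X X' : slit z -> smooth_near z X ->
  (\forall q \near at_pt z, X q = X' q) ->
  \forall q \near at_pt z, hproj S X q = hproj S X' q.
Proof.
move=> sz sX XX'; have sX' := smooth_near_eq hTM XX' sX.
have good : \forall q \near at_pt z, [/\ slit q, smooth_near q X & smooth_near q X'].
  by apply: filterS3 (nslit sz) (smooth_near_near hTM sX) (smooth_near_near hTM sX').
by apply: filterS2 good XX' => q [sq sXq sXq'] e; exact: (hproj_eq hF).
Qed.

Lemma connection_hproj_J z X Y : slit z -> smooth_near z X -> smooth_near z Y ->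
  D (hproj S X) (J Y) z = vproj S (bracket (hproj S X) (J Y)) z + T' z (X z) (Y z).
Proof.
move=> sz sX sY; have [_ _ h _] := hD; have [_ _ h0 _] := hD0.
by rewrite h // h0.
Qed.

(** The deflection D_{hX} C of the Cartan connection is tensorial in X. For X =
d/dx^i, its Berwald part v[hX, C] vanishes by homogeneity, and so does T'(X, S). *)
Lemma connection_hproj_spray z X : slit z -> smooth_near z X ->
  D (hproj S X) (J S) z = 0.
Proof.
move=> sz sX; have cz := dom_chart_at hTM z; set c := chart_at z in cz.
have sJS := sJ (sS sz).
pose Phi Y := D (hproj S Y) (J S) z.
change (Phi X = 0); apply: (@tensorial0 _ _ _ hTM _ z Phi _ _ _ c X cz sX).
- move=> Y Y' sY YY'; apply: (connection_eq hTM lin sz (sh sz sY) sJS).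
    exact: near_hproj_eq.
  exact: filterE.
- move=> Y Y' sY sY'.
  have sYY' := smooth_vadd hTM sY sY'.
  apply: etrans _ (connectionDl lin sz (sh sz sY) (sh sz sY') sJS).
  apply: (connection_eq hTM lin sz (sh sz sYY') sJS); last exact: filterE.
  have good := near_and3 (nslit sz) (smooth_near_near hTM sY) (smooth_near_near hTM sY').
  by apply: filterS good => q [sq sYq sYq']; exact: (hproj_vadd hM hF).
- move=> f Y sf sY; have sfY := smooth_vscale hTM sf sY.
  apply: etrans _ (connectionZl lin sz sf (sh sz sY) sJS).
  apply: (connection_eq hTM lin sz (sh sz sfY) sJS); last exact: filterE.
  have good := near_and3 (nslit sz) (smooth_near_near hTM sY) (smooth_function_near_near hTM sf).
  by apply: filterS good => q [sq sYq sfq]; exact: (hproj_vscale hM hF).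
move=> xi; have sxi := smooth_chart_field hTM xi cz.
pose a := lsubmx xi; have sdx := smooth_dx hM a cz.
have eh : \forall q \near at_pt z, hproj S (chart_field c xi) q = hproj S (dx c a) q.
  have good := near_and3 (nslit sz) (smooth_near_near hTM sxi) (smooth_near_near hTM sdx).
  apply: filterS3 good (near_J_chart_field hM xi cz) (near_J_dx hM a cz) => q [sq sq1 sq2] e1 e2.
  rewrite -(hproj_FJ hF sq sq1) -(hproj_FJ hF sq sq2); congr (_ *m _).
  by apply: etrans e1 _; apply: etrans _ (esym e2); rewrite mul_Jmx.
apply: etrans (connection_eq hTM lin sz (sh sz sxi) sJS eh (filterE _ (fun q => erefl))) _.
have sb : smooth_near z (bracket (hproj S (dx c a)) (J S)).
  exact: (smooth_bracket hTM (sh sz sdx) sJS).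
rewrite (connection_hproj_J sz sdx (sS sz)).
rewrite (second_cartan_tensor_spray hM hE hS hF hT' a sz cz) addr0.
apply: (vproj_eq0 sz sb).
rewrite (bracket_eqr hTM (sh sz sdx) sJS (near_J_spray hM hE hS sz)).
exact: (bracket_hproj_dx_liouville hM hE hS hF).
Qed.

(** D_{JX} C = J[JX, S] + T(X, S), where the first term is JX and the second is
zero. *)
Lemma connection_J_spray z X : slit z -> smooth_near z X -> D (J X) (J S) z = J X z.
Proof.
move=> sz sX; have [_ h _ _] := hD; have [_ h0 _ _] := hD0.
have sSz := sS sz; rewrite h // h0 // /tapp.
rewrite (first_cartan_tensor_spray hM hE hS hF hT) // addr0.
exact: (J_bracket_J_spray hM hS hF).
Qed.

(** Horizontal derivatives of C vanish, so that only - D_{[hX, hY]} C is left of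
the curvature: R(X, Y) applied to S is, up to sign, the curvature of the Barthel
connection. *)
Lemma h_curvature_spray z X Y : slit z -> smooth_near z X -> smooth_near z Y ->
  h_curvature S D X Y S z = - vproj S (bracket (hproj S X) (hproj S Y)) z.
Proof.
move=> sz sX sY; have sJS := sJ (sS sz).
have shX := sh sz sX; have shY := sh sz sY.
rewrite /h_curvature curvatureE.
have hC A Z : smooth_near z A -> smooth_near z Z -> D A (D (hproj S Z) (J S)) z = 0.
  move=> sA sZ; apply: (connection0r hTM lin sz sA).
    exact: (connection_smooth lin sz (sh sz sZ) sJS).
  apply: filterS2 (nslit sz) (smooth_near_near hTM sZ) => q sq sZq.
  exact: connection_hproj_spray.
have arith (u v w w' : 'rV[R]_(n + n)) : u = 0 -> v = 0 -> w = w' -> u - v - w = - w'.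
  by move=> -> -> ->; rewrite subrr sub0r.
apply: (arith _ _ _ _ (hC _ _ shX sY) (hC _ _ shY sX)).
have : smooth_near z (bracket (hproj S X) (hproj S Y)) by exact: smooth_bracket.
generalize (bracket (hproj S X) (hproj S Y)) => B sB.
have svB := smooth_vproj hM hS sz sB.
have JvB : \forall q \near at_pt z, J (vproj S B) q = 0.
  apply: filterS2 (nslit sz) (smooth_near_near hTM sB) => q sq sBq.
  exact: (J_vproj hM hS hF).
have [W sW vW] := vertical_lift hM svB JvB.
have split_B : \forall q \near at_pt z, B q = vadd (hproj S B) (J W) q.
  by apply: filterS vW => q e; rewrite /vadd -e vprojE addrC subrK.
apply: etrans (connection_eq hTM lin sz sB sJS split_B (filterE _ (fun q => erefl))) _.
rewrite (connectionDl lin sz (sh sz sB) (sJ sW) sJS).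
rewrite (connection_hproj_spray sz sB) (connection_J_spray sz sW) add0r.
exact: esym (at_pt_self hTM vW).
Qed.

Definition vertical_near z V :=
  smooth_near z V /\ \forall q \near at_pt z, J V q = 0.

Definition horizontal_near z X :=
  smooth_near z X /\ \forall q \near at_pt z, hproj S X q = X q.

Lemma vertical_near_near z V : vertical_near z V -> \forall q \near at_pt z, vertical_near q V.
Proof.
move=> [sV JV]; apply: filterS2 (smooth_near_near hTM sV) (at_pt_near hTM JV).
by move=> q; split.
Qed.

Lemma horizontal_near_near z X : horizontal_near z X ->
  \forall q \near at_pt z, horizontal_near q X.
Proof.
move=> [sX hX]; apply: filterS2 (smooth_near_near hTM sX) (at_pt_near hTM hX).
by move=> q; split.
Qed.

Lemma vertical_near_J z W : smooth_near z W -> vertical_near z (J W).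
Proof. by move=> sW; split; [exact: sJ|apply: filterE => q; exact: JJ]. Qed.

Lemma horizontal_near_hproj z X : slit z -> smooth_near z X ->
  horizontal_near z (hproj S X).
Proof.
move=> sz sX; split; first exact: sh.
apply: filterS2 (nslit sz) (smooth_near_near hTM sX) => q sq sXq.
exact: (hproj_hproj hM hS hF).
Qed.

(** D_{hX} JY = v[hX, JY] + T'(X, Y), and both terms are vertical. *)
Lemma connection_vertical z X V : slit z -> horizontal_near z X ->
  vertical_near z V -> vertical_near z (D X V).
Proof.
move=> sz [sX hX] [sV JV].
have [W sW vW] := vertical_lift hM sV JV.
split; first exact: (connection_smooth lin sz sX sV).
have hX' : \forall q \near at_pt z, X q = hproj S X q by apply: filterS hX => q ->.
have good := near_and3 (nslit sz) (smooth_near_near hTM sX) (smooth_near_near hTM sW).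
apply: filterS2 good (connection_near_eq hTM oslit lin sz sX sV hX' vW) => q [sq sXq sWq] e.
rewrite /J e (connection_hproj_J sq sXq sWq) mulmxDl.
have [+ _] := hT' => /(_ q sq)[_ _ _ -> _]; rewrite addr0.
apply: (J_vproj hM hS hF) => //.
exact: (smooth_bracket hTM (sh sq sXq) (sJ sWq)).
Qed.

Section null_distribution.
Variables (U : set TM) (oU : open_in U) (Uslit : forall z, U z -> slit z).

Definition null_field X :=
  smooth_on U X /\ in_distribution U (nullity_space S D) X.

Lemma null_smooth X z : null_field X -> U z -> smooth_near z X.
Proof. by move=> [sX _] Uz; exists U. Qed.

Lemma null_horizontal X z : null_field X -> U z -> horizontal_near z X.
Proof.
move=> nX Uz; split; first exact: null_smooth.
apply: filterS (open_in_near hTM oU Uz) => q Uq.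
have sq := Uslit Uq; have sXq := null_smooth nX Uq.
have [_ /(_ q Uq)[[X0 sX0 e] _]] := nX.
by rewrite (hproj_eq hF sq sXq (sh sq sX0) (esym e)) (hproj_hproj hM hS hF sq sX0).
Qed.

Lemma null_curvature X B V z : null_field X -> U z -> horizontal_near z B ->
  vertical_near z V -> curvature D X B V z = 0.
Proof.
move=> nX Uz [sB hB] [sV JV]; have sz := Uslit Uz.
have [W sW vW] := vertical_lift hM sV JV.
have [sX hX] := null_horizontal nX Uz.
have [_ /(_ z Uz)[_ null]] := nX.
rewrite -[RHS](null X B W sX sB sW erefl); apply: (curvature_eq hTM oslit lin sz sX sB sV) => //.
- by apply: filterS hX => q ->.
- by apply: filterS hB => q ->.
Qed.

(** By [h_curvature_spray], the vertical part of [X, B] is - R(X, B)S = 0. *)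
Lemma null_bracket X B z : null_field X -> U z -> horizontal_near z B ->
  horizontal_near z (bracket X B).
Proof.
move=> nX Uz hBz; have sX := null_smooth nX Uz; have [sB _] := hBz.
split; first exact: (smooth_bracket hTM sX sB).
apply: filterS2 (open_in_near hTM oU Uz) (horizontal_near_near hBz) => q Uq [sBq hBq].
have sq := Uslit Uq; have [sXq hXq] := null_horizontal nX Uq.
have [_ /(_ q Uq)[_ null]] := nX.
have sXB := smooth_bracket hTM sXq sBq.
have shXB := smooth_bracket hTM (sh sq sXq) (sh sq sBq).
have e := bracket_eq hTM (sh sq sXq) (sh sq sBq) hXq hBq.
have := null X B S sXq sBq (sS sq) erefl.
rewrite (h_curvature_spray sq sXq sBq) vprojE => /eqP.
rewrite oppr_eq0 subr_eq0 => /eqP v0.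
by rewrite -(hproj_eq hF sq shXB sXB e) -v0.
Qed.

(** On vertical fields K(X, B) = 0, so that the operators D satisfy the bracket
relation of X and B exactly. *)
Lemma null_commute X B V z : null_field X -> U z -> horizontal_near z B ->
  vertical_near z V -> D (bracket X B) V z = D X (D B V) z - D B (D X V) z.
Proof.
move=> nX Uz hB vV; have := null_curvature nX Uz hB vV; rewrite curvatureE.
by move=> /eqP; rewrite subr_eq0 => /eqP ->.
Qed.

Lemma null_commute_near X B V z : null_field X -> U z -> horizontal_near z B ->
  vertical_near z V ->
  \forall q \near at_pt z, D (bracket X B) V q = vsub (D X (D B V)) (D B (D X V)) q.
Proof.
move=> nX Uz hB vV.
have good := near_and3 (open_in_near hTM oU Uz)
  (horizontal_near_near hB) (vertical_near_near vV).
by apply: filterS good => q [Uq hBq vVq]; exact: null_commute.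
Qed.

(** The second Bianchi identity, in which all torsion terms vanish. On vertical
fields, D_{[A, H]} = [D_A, D_H] for A = X or Y and every horizontal H. This
applies to H = B and, by [null_bracket], to H = [X, B] and H = [Y, B]. Hence
D_{[[X, Y], B]} = [D_X, [D_Y, D_B]] - [D_Y, [D_X, D_B]] = [[D_X, D_Y], D_B] =
[D_{[X, Y]}, D_B]. *)
Lemma null_bianchi X Y B V z : null_field X -> null_field Y -> U z ->
  horizontal_near z B -> vertical_near z V -> curvature D (bracket X Y) B V z = 0.
Proof.
move=> nX nY Uz hB vV; have sz := Uslit Uz.
have hX := null_horizontal nX Uz; have hY := null_horizontal nY Uz.
have [[sX _] [sY _] [sB _] [sV _]] := And4 hX hY hB vV.
have vD A : horizontal_near z A -> vertical_near z (D A V).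
  by move=> hA; exact: connection_vertical.
have [vX vY vB] := And3 (vD X hX) (vD Y hY) (vD B hB).
have sD A A' : horizontal_near z A -> horizontal_near z A' -> smooth_near z (D A (D A' V)).
  by move=> hA hA'; have [] := connection_vertical sz hA (vD A' hA').
have hYB := null_bracket nY Uz hB; have hXB := null_bracket nX Uz hB.
have sXY := smooth_bracket hTM sX sY.
have [[sYB _] [sXB _]] := conj hYB hXB.
rewrite curvatureE.
(* The commutator of D_{[X, Y]} and D_B. *)
have e1 := null_commute nX Uz hY vB.
have e2 : D B (D (bracket X Y) V) z = D B (D X (D Y V)) z - D B (D Y (D X V)) z.
  apply: etrans _ (connectionBr hTM lin sz sB (sD X Y hX hY) (sD Y X hY hX)).
  apply: (connection_eq hTM lin sz sB (connection_smooth lin sz sXY sV)).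
    exact: filterE.
  exact: null_commute_near.
(* The operator of the double bracket, by the Jacobi identity. *)
have e3 : D (bracket (bracket X Y) B) V z =
    D (bracket X (bracket Y B)) V z - D (bracket Y (bracket X B)) V z.
  have s1 := smooth_bracket hTM sX sYB; have s2 := smooth_bracket hTM sY sXB.
  have s3 := smooth_bracket hTM sXY sB.
  apply: etrans _ (connectionBl hTM lin sz s1 s2 sV).
  apply: (connection_eq hTM lin sz s3 sV); last exact: filterE.
  have good := near_and3 (smooth_near_near hTM sX)
    (smooth_near_near hTM sY) (smooth_near_near hTM sB).
  apply: filterS good => q [sXq sYq sBq].
  have jac := jacobi hTM sXq sYq sBq.
  apply: etrans (esym (addrK (bracket Y (bracket X B) q) _)) _.
  exact: (congr1 (fun u => u - bracket Y (bracket X B) q) (esym jac)).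
have e4 := null_commute nX Uz hYB vV.
have e5 := null_commute nY Uz hXB vV.
have e6 : D X (D (bracket Y B) V) z = D X (D Y (D B V)) z - D X (D B (D Y V)) z.
  apply: etrans _ (connectionBr hTM lin sz sX (sD Y B hY hB) (sD B Y hB hY)).
  apply: (connection_eq hTM lin sz sX (connection_smooth lin sz sYB sV)).
    exact: filterE.
  exact: null_commute_near.
have e7 : D Y (D (bracket X B) V) z = D Y (D X (D B V)) z - D Y (D B (D X V)) z.
  apply: etrans _ (connectionBr hTM lin sz sY (sD X B hX hB) (sD B X hB hX)).
  apply: (connection_eq hTM lin sz sY (connection_smooth lin sz sXB sV)).
    exact: filterE.
  exact: null_commute_near.
have e8 := null_commute nY Uz hB vX.
have e9 := null_commute nX Uz hB vY.
have arith (xyb yxb bxy byx xby ybx d1 d2 d3 d4 d5 d6 d7 d8 d9 : 'rV[R]_(n + n)) :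
  d1 = xyb - yxb -> d2 = bxy - byx -> d3 = d4 - d5 ->
  d4 = d6 - d8 -> d5 = d7 - d9 -> d6 = xyb - xby -> d7 = yxb - ybx ->
  d8 = ybx - byx -> d9 = xby - bxy -> d1 - d2 - d3 = 0.
  by move=> -> -> -> -> -> -> -> -> ->; apply/rowP => j; rewrite !mxE; ring.
exact: (arith _ _ _ _ _ _ _ _ _ _ _ _ _ _ _ e1 e2 e3 e4 e5 e6 e7 e8 e9).
Qed.

(** The h-curvature is tensorial in its first argument, so that an arbitrary
extension of the vector [X, Y] at z may be replaced by the field [X, Y]. *)
Lemma null_integrable : completely_integrable U (nullity_space S D).
Proof.
move=> X Y sX sY dX dY z Uz.
have nX : null_field X by split.
have nY : null_field Y by split.
have sz := Uslit Uz; have hY := null_horizontal nY Uz.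
have hXY := null_bracket nX Uz hY; have [sXY hXYe] := hXY.
split; first by exists (bracket X Y) => //; exact: (at_pt_self hTM hXYe).
move=> X' Y' W sX' sY' sW e.
have shY' := sh sz sY'; have sJW := sJ sW.
pose Phi A := curvature D (hproj S A) (hproj S Y') (J W) z.
have -> : h_curvature S D X' Y' W z = Phi (bracket X Y).
  change (Phi X' = Phi (bracket X Y)).
  apply: (@tensorial_eq _ _ _ hTM _ z Phi _ _ _ X' (bracket X Y) sX' sXY e).
  - move=> A A' sA AA'.
    apply: (curvature_eq hTM oslit lin sz (sh sz sA) shY' sJW); last exact: filterE.
      exact: near_hproj_eq.
    exact: filterE.
  - move=> A A' sA sA'; have sAA' := smooth_vadd hTM sA sA'.
    apply: etrans _ (curvatureDl hTM oslit lin sz (sh sz sA) (sh sz sA') shY' sJW).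
    apply: (curvature_eq hTM oslit lin sz (sh sz sAA') shY' sJW); try exact: filterE.
    have good := near_and3 (nslit sz) (smooth_near_near hTM sA) (smooth_near_near hTM sA').
    by apply: filterS good => q [sq sAq sAq']; exact: (hproj_vadd hM hF).
  - move=> f A sf sA; have sfA := smooth_vscale hTM sf sA.
    apply: etrans _ (curvatureZl hTM oslit lin sz sf (sh sz sA) shY' sJW).
    apply: (curvature_eq hTM oslit lin sz (sh sz sfA) shY' sJW); try exact: filterE.
    have good := near_and3 (nslit sz) (smooth_near_near hTM sA) (smooth_function_near_near hTM sf).
    by apply: filterS good => q [sq sAq sfq]; exact: (hproj_vscale hM hF).
have hB := horizontal_near_hproj sz sY'; have vV := vertical_near_J sW.
rewrite -[RHS](null_bianchi nX nY Uz hB vV).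
by apply: (curvature_eq hTM oslit lin sz (sh sz sXY) shY' sJW) => //; exact: filterE.
Qed.

End null_distribution.

End nullity.

Theorem theorem4p8 (R : realType) (n : nat) (M : charted R n)
    (hM : smooth_manifold M)
    (E : tangent_bundle M -> R) (hE : finsler_space E)
    (S : vfield (tangent_bundle M)) (hS : canonical_spray E S)
    (F : tangent_bundle M -> 'M[R]_(n + n)) (hF : almost_complex_structure S F)
    (D0 : vfield (tangent_bundle M) -> vfield (tangent_bundle M) ->
          vfield (tangent_bundle M))
    (hD0 : berwald_connection S F D0)
    (T T' : tensor2 M)
    (hT : first_cartan_tensor E F T) (hT' : second_cartan_tensor E S F T')
    (D : vfield (tangent_bundle M) -> vfield (tangent_bundle M) ->
         vfield (tangent_bundle M))
    (hD : cartan_connection S F D0 T T' D)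
    (U : set (tangent_bundle M)) (hU : open_in U)
    (hU0 : forall z, U z -> slit z)
    (hmu : exists k : nat, forall z, U z -> nullity_index S D z k) :
  completely_integrable U (nullity_space S D).
Proof.
exact: (null_integrable (smooth_manifold_atlas hM) hE hS hF hD0 hT hT' hD hU hU0).
Qed.
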